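(* Let $1\leq p<\infty$ and let $\gamma\colon\mathbb{T}\to\mathbb{R}^2$ be a Jordan parametrization of finite $p$-variation. For every real $q>p$, there exists a sequence of smooth Jordan embeddings $\gamma_n\colon\mathbb{T}\to\mathbb{R}^2$ such that $$|\gamma_n(0)-\gamma(0)|+\lVert\gamma_n-\gamma\rVert_{q\text{-var}}\longrightarrow 0\quad\text{as } n\to\infty.$$
   Context: Let $\mathbb{T}=[0,1]/\{0,1\}$ denote the circle obtained by identifying $0$ and $1$. A Jordan parametrization is a continuous injective map $\gamma\colon\mathbb{T}\to\mathbb{R}^2$, also regarded as a continuous path on $[0,1]$ with $\gamma(0)=\gamma(1)$. A smooth Jordan embedding is a $C^\infty$ injective map $\mathbb{T}\to\mathbb{R}^2$ (smooth as a map on the circle) whose derivative vanishes nowhere. For a continuous path $x\colon[0,1]\to\mathbb{R}^d$ and real $r\geq 1$, the $r$-variation is $$\lVert x\rVert_{r\text{-var}}=\left(\sup_{\mathcal{D}}\sum_j |x(t_j)-x(t_{j-1})|^r\right)^{1/r},$$ where the supremum is over all finite partitions $\mathcal{D}=\{0=t_0<\cdots<t_m=1\}$. The path has finite $r$-variation if this quantity is finite. The $r$-variation of a map on $\mathbb{T}$ is that of the corresponding path on $[0,1]$. *)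

(* Defs.v *)
From mathcomp Require Import all_boot all_order all_algebra.
From mathcomp Require Import all_classical all_reals all_analysis.

Set Implicit Arguments.
Unset Strict Implicit.
Unset Printing Implicit Defensive.

Import Order.TTheory GRing.Theory Num.Theory.
Import numFieldNormedType.Exports.

Local Open Scope classical_set_scope.
Local Open Scope ring_scope.

(* The norm [`|x|] of the library on ['rV[R]_d] is the sup norm, so the
   Euclidean norm is defined here. *)
Definition enorm (R : realType) (d : nat) (x : 'rV[R]_d) : R :=
  Num.sqrt (\sum_(i < d) x ord0 i ^+ 2).

(* As in the library, a partition [0 = t_0 < ... < t_m = 1] is given by
   [s = [:: t_1; ...; t_m]] with [itv_partition 0 1 s]. *)
Definition rvariation_sum (R : realType) (d : nat) (r : R)
    (x : R -> 'rV[R]_d) (s : seq R) : R :=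
  let X := x \o nth 1 (0 :: s) in
  \sum_(0 <= j < size s) enorm (X j.+1 - X j) `^ r.

(* Only the values of [x] on [[0, 1]] matter; the value may be [+oo]. *)
Definition rvar (R : realType) (d : nat) (r : R) (x : R -> 'rV[R]_d) : \bar R :=
  (ereal_sup [set (rvariation_sum r x s)%:E | s in itv_partition (0 : R) 1]%R
     `^ r^-1)%E.

(* A map on the circle [[0, 1] / {0, 1}], i.e. on [R / Z], is represented by its
   lift, a 1-periodic function on [R]: continuity and smoothness on the circle
   are those of the lift, and injectivity on the circle is injectivity of the
   lift on the fundamental domain [[0, 1)]. *)
Definition jordan_parametrization (R : realType) (g : R -> 'rV[R]_2) : Prop :=
  [/\ periodic g 1, continuous g & {in `[0, 1[ &, injective g}].

Definition smooth (R : realType) (g : R -> 'rV[R]_2) : Prop :=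
  forall (k : nat) (t : R), derivable (g^`(k))%classic t 1.

Definition smooth_jordan_embedding (R : realType) (g : R -> 'rV[R]_2) : Prop :=
  [/\ periodic g 1, smooth g, {in `[0, 1[ &, injective g}
    & forall t : R, (g^`())%classic t != 0].

(* Main.v *)
Require Import Defs.
From mathcomp Require Import all_boot all_order all_algebra.
From mathcomp Require Import all_classical all_reals all_analysis.
From mathcomp Require Import ring lra zify.
Import Order.TTheory GRing.Theory Num.Theory.
Import numFieldNormedType.Exports.
Local Open Scope classical_set_scope.
Local Open Scope ring_scope.

Set Implicit Arguments.
Unset Strict Implicit.
Unset Printing Implicit Defensive.

(* For q > p, the sums defining the q-variation of a path are at most a power
   of its sup norm times those of its p-variation.  So it suffices to approximate
   gamma uniformly by smooth embeddings of bounded p-variation.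

   Rounding gamma to a lattice of mesh e gives a closed walk along lattice
   edges.  Its loops are short in time, since gamma is injective, and are erased.
   The remaining vertices are distinct, hence there are only O(e^-p) of them, and
   this bounds the p-variation of the simple lattice polygon P that they span.

   Along P some linear functional increases at a definite rate near each time.
   Convolution with the kernel ((1 + cos(2 pi s)) / 2)^n, for n large, preserves
   this, which makes the convolution an immersion that is injective at small
   scales; at large scales injectivity follows from uniform closeness to P. *)

(** * Mean value of a function over the circle *)

(** The obstacle is injectivity: in general neither sampling nor convolving [gamma] keeps it simple.
    On a lattice it becomes combinatorial, because distinct edges meet only at vertices, so a closed
    walk of at least three edges with distinct vertices spans a simple polygon. Each edge carries
    its own time stamp, at which both its ends are close to the curve; erasing loops leaves the
    stamps of the surviving edges unchanged up to full periods, so increments of [P] stay comparable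
    with those of [gamma]. The error in this comparison is of order [e ^ p] per edge, and this is
    why the number of vertices must be counted.

    The smooth curve is not controlled in p-variation directly. Convolution preserves the Lipschitz
    constant [L] of [P], so its difference with [P] has bounded 1-variation, and the uniform
    distance to [P] is chosen after [L], however large [L] is. Sup norms are used throughout; the
    Euclidean norm is recovered at the end up to a factor [2]. *)

Lemma within_continuousT (R : realType) (F : R -> R) (A : set R) :
  continuous F -> {within A, continuous F}.
Proof. by move=> cF; apply: continuous_subspaceT. Qed.

Definition antider (R : realType) (a b : R) (Phi F : R -> R) : Prop :=
  forall x, a < x < b -> is_derive x 1 Phi (F x).

Lemma antider_exists (R : realType) (a b : R) (F : R -> R) :
  continuous F -> exists Phi, antider a b Phi F.
Proof.
move=> cF; exists (fun x => \int[lebesgue_measure]_(t in `[a, x]) F t) => x /andP[ax xb].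
have iF : lebesgue_measure.-integrable `[a, b] (EFin \o F).
  apply: continuous_compact_integrable; first exact: segment_compact.
  exact: within_continuousT.
have [d1 d2] := @continuous_FTC1_closed R F a x b xb iF ax (cF x).
by apply: DeriveDef; [exact: d1|rewrite -derive1E; exact: d2].
Qed.

Lemma antider_cvg (R : realType) (a b c d : R) (Phi F : R -> R) :
  a < c -> d < b -> antider a b Phi F -> {within `[c, d], continuous Phi}.
Proof.
move=> ac db aF; apply: derivable_within_continuous => x.
rewrite in_itv/= => /andP[cx xd].
have x1 : a < x < b by rewrite (lt_le_trans ac cx) (le_lt_trans xd db).
by have := aF _ x1; case.
Qed.

Lemma antider_MVT (R : realType) (a b c d : R) (Phi F : R -> R) :
  a < c -> c < d -> d < b -> antider a b Phi F ->
  exists2 e, c < e < d & Phi d - Phi c = F e * (d - c).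
Proof.
move=> ac cd db aF.
have [e ecd eE] : exists2 e, e \in `]c, d[%R & Phi d - Phi c = F e * (d - c).
  apply: MVT => //; last exact: antider_cvg ac db aF.
  move=> x; rewrite in_itv/= => /andP[cx xd]; apply: aF.
  by rewrite (lt_trans ac cx) (lt_trans xd db).
by exists e => //; move: ecd; rewrite in_itv.
Qed.

(** For continuous [F] this is the integral over [[0, 1]], taken from an antiderivative so that
    linearity, shifts and integration by parts reduce to differentiation. The interval []-1, 2[] has
    [0] and [1] in its interior, and by [meanE] the choice made by [xget] does not matter. *)
Definition mean (R : realType) (F : R -> R) : R :=
  let Phi := xget (cst 0) [set Phi | antider (-1) 2 Phi F] in Phi 1 - Phi 0.

Lemma antiderB (R : realType) (a b : R) (Phi Psi F G : R -> R) :
  antider a b Phi F -> antider a b Psi G ->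
  antider a b (fun x => Phi x - Psi x) (fun x => F x - G x).
Proof.
by move=> aF aG x xab; have := aF _ xab; have := aG _ xab => ? ?; apply: is_deriveB.
Qed.

Lemma antiderD (R : realType) (a b : R) (Phi Psi F G : R -> R) :
  antider a b Phi F -> antider a b Psi G ->
  antider a b (fun x => Phi x + Psi x) (fun x => F x + G x).
Proof.
by move=> aF aG x xab; have := aF _ xab; have := aG _ xab => ? ?; apply: is_deriveD.
Qed.

Lemma antiderZ (R : realType) (a b k : R) (Phi F : R -> R) :
  antider a b Phi F -> antider a b (fun x => k * Phi x) (fun x => k * F x).
Proof.
by move=> aF x xab; have := aF _ xab => ?; apply: is_deriveZ.
Qed.

Lemma antider0_cst (R : realType) (a b c d : R) (Phi : R -> R) :
  antider a b Phi (cst 0) -> a < c < b -> a < d < b -> Phi c = Phi d.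
Proof.
move=> aF /andP[ac cb] /andP[ad db].
have [cd|dc|->//] := ltgtP c d.
  have [e _ /eqP] := antider_MVT ac cd db aF.
  by rewrite mul0r subr_eq0 => /eqP.
have [e _ /eqP] := antider_MVT ad dc cb aF.
by rewrite mul0r subr_eq0 => /eqP.
Qed.

Lemma meanE (R : realType) (Phi F : R -> R) :
  antider (-1) 2 Phi F -> mean F = Phi 1 - Phi 0.
Proof.
move=> aF; rewrite /mean.
have := xgetPex (cst 0) (ex_intro _ Phi aF : exists x, [set Phi | antider (-1) 2 Phi F] x).
rewrite /=; set Psi := xget _ _ => aP.
have a0 : antider (-1) 2 (fun x => Psi x - Phi x) (cst 0).
  have := antiderB aP aF.
  by congr antider; apply/funext => x; rewrite subrr.
have := @antider0_cst _ _ _ 1 0 _ a0.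
have -> : -1 < 1 :> R by lra.
have -> : 1 < 2 :> R by lra.
have -> : -1 < 0 :> R by lra.
have -> : 0 < 2 :> R by lra.
by move=> /(_ isT isT); lra.
Qed.

Lemma meanD (R : realType) (F G : R -> R) : continuous F -> continuous G ->
  mean (fun x => F x + G x) = mean F + mean G.
Proof.
move=> /(antider_exists (-1) 2)[Phi aF] /(antider_exists (-1) 2)[Psi aG].
by rewrite (meanE (antiderD aF aG)) (meanE aF) (meanE aG); ring.
Qed.

Lemma meanB (R : realType) (F G : R -> R) : continuous F -> continuous G ->
  mean (fun x => F x - G x) = mean F - mean G.
Proof.
move=> /(antider_exists (-1) 2)[Phi aF] /(antider_exists (-1) 2)[Psi aG].
by rewrite (meanE (antiderB aF aG)) (meanE aF) (meanE aG); ring.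
Qed.

Lemma meanZ (R : realType) (k : R) (F : R -> R) : continuous F ->
  mean (fun x => k * F x) = k * mean F.
Proof.
move=> /(antider_exists (-1) 2)[Phi aF].
by rewrite (meanE (antiderZ k aF)) (meanE aF); ring.
Qed.

Lemma mean_MVT (R : realType) (F : R -> R) : continuous F ->
  exists2 e, 0 < e < 1 & mean F = F e.
Proof.
move=> /(antider_exists (-1) 2)[Phi aF]; rewrite (meanE aF).
have h1 : -1 < 0 :> R by lra.
have h2 : 0 < 1 :> R by lra.
have h3 : 1 < 2 :> R by lra.
have [e e01 ->] := antider_MVT h1 h2 h3 aF.
by exists e => //; lra.
Qed.

Lemma mean_ge0 (R : realType) (F : R -> R) : continuous F -> (forall x, 0 <= F x) ->
  0 <= mean F.
Proof. by move=> /mean_MVT[e _ ->]. Qed.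

Lemma is_derive_comp_shift (R : realType) (F : R -> R) (x t d : R) :
  is_derive (x + t) 1 F d -> is_derive x 1 (fun s => F (s + t)) d.
Proof.
move=> dF; rewrite -[d]mulr1; apply: (@is_derive1_comp R F (shift t)) => //.
exact: is_derive_shift.
Qed.

(** By periodicity [Phi (s + 1) - Phi s] has zero derivative, so it takes the same value at [t] and
    at [0]. The antiderivative lives on a longer interval because [s + t] and [s + 1] may leave
    []-1, 2[]. *)
Lemma mean_shift01 (R : realType) (F : R -> R) (t : R) :
  continuous F -> periodic F 1 -> 0 <= t <= 1 -> mean (fun s => F (s + t)) = mean F.
Proof.
move=> cF pF /andP[t0 t1].
have [Phi aF] := antider_exists (-1) 4 cF.
have aFt : antider (-1) 2 (fun s => Phi (s + t)) (fun s => F (s + t)).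
  move=> x /andP[x1 x2]; have xt : -1 < x + t < 4 by apply/andP; split; lra.
  exact/is_derive_comp_shift/aF.
rewrite (meanE aFt) add0r.
have aF' : antider (-1) 2 Phi F.
  by move=> x /andP[x1 x2]; apply: aF; apply/andP; split; lra.
rewrite (meanE aF').
have aH : antider (-1) 2 (fun s => Phi (s + 1) - Phi s) (cst 0).
  move=> x /andP[x1 x2].
  have h1 : -1 < x < 4 by apply/andP; split; lra.
  have h2 : -1 < x + 1 < 4 by apply/andP; split; lra.
  have := aF _ h1 => ?; have ? := aF _ h2.
  have ? : is_derive x 1 (fun s => Phi (s + 1)) (F (x + 1)) by exact: is_derive_comp_shift.
  by rewrite -[cst 0 x](subrr (F x)) -{1}pF; apply: is_deriveB.
have := @antider0_cst _ _ _ t 0 _ aH.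
have -> : -1 < t < 2 by lra.
have -> : -1 < (0:R) < 2 by lra.
by rewrite add0r (addrC t); apply.
Qed.

Lemma periodicz (R : realType) (V : zmodType) (F : R -> V) (k : int) (x : R) :
  periodic F 1 -> F (x + k%:~R) = F x.
Proof.
move=> pF; have pn n y : F (y + n%:R) = F y.
  by rewrite periodicn.
case: k => n; first by rewrite -pmulrn pn.
by rewrite NegzE mulrNz -pmulrn -(pn n.+1) subrK.
Qed.

Lemma mean_shift (R : realType) (F : R -> R) (t : R) :
  continuous F -> periodic F 1 -> mean (fun s => F (s + t)) = mean F.
Proof.
move=> cF pF; set k := Num.floor t.
have E : (fun s => F (s + t)) = (fun s => F (s + (t - k%:~R))).
  by apply/funext => s; rewrite -(periodicz k (s + (t - _)) pF); congr F; ring.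
rewrite E mean_shift01//.
have := floor_itv t => /andP[].
by rewrite intrD -/k => h1 h2; apply/andP; split; lra.
Qed.

(** * Trigonometric kernels *)

Definition cos1 (R : realType) (s : R) : R := cos (2 * pi * s).
Definition sin1 (R : realType) (s : R) : R := sin (2 * pi * s).

Lemma is_derive_cos1 (R : realType) (x : R) :
  is_derive x 1 (@cos1 R) (- (2 * pi) * sin1 x).
Proof.
have d : is_derive x 1 ( *%R (2 * pi : R)) (2 * pi).
  have := @is_deriveZ R R R id (2 * pi) x 1 1 (is_derive_id _ _).
  by rewrite [_ *: 1]mulr1.
apply: is_derive_eq (@is_derive1_comp R cos ( *%R (2 * pi)) x _ _ (is_derive_cos _) d) _.
by rewrite /sin1; ring.
Qed.

Lemma is_derive_sin1 (R : realType) (x : R) :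
  is_derive x 1 (@sin1 R) (2 * pi * cos1 x).
Proof.
have d : is_derive x 1 ( *%R (2 * pi : R)) (2 * pi).
  have := @is_deriveZ R R R id (2 * pi) x 1 1 (is_derive_id _ _).
  by rewrite [_ *: 1]mulr1.
apply: is_derive_eq (@is_derive1_comp R sin ( *%R (2 * pi)) x _ _ (is_derive_sin _) d) _.
by rewrite /cos1; ring.
Qed.

Lemma is_derive_continuous (R : realType) (F F' : R -> R) :
  (forall x : R, is_derive x 1 F (F' x)) -> continuous F.
Proof.
move=> dF x; apply/differentiable_continuous/derivable1_diffP.
by have [] := dF x.
Qed.

Lemma continuous_cos1 (R : realType) : continuous (@cos1 R).
Proof. exact: is_derive_continuous (@is_derive_cos1 R). Qed.

Lemma continuous_sin1 (R : realType) : continuous (@sin1 R).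
Proof. exact: is_derive_continuous (@is_derive_sin1 R). Qed.

Lemma periodic_cos1 (R : realType) : periodic (@cos1 R) 1.
Proof. by move=> x; rewrite /cos1 mulrDr mulr1 mulr_natl cosD2pi. Qed.

Lemma cos1B (R : realType) (s t : R) :
  cos1 (s - t) = cos1 s * cos1 t + sin1 s * sin1 t.
Proof. by rewrite /cos1 mulrBr cosB. Qed.

(** The minimum over the compact interval is attained, and the half-angle formula writes it as
    [2 * sin (pi * c) ^+ 2], positive for [0 < c < 1]. *)
Lemma cos1_gap (R : realType) (d : R) : 0 < d < 1 / 2 ->
  exists2 k : R, 0 < k & forall s, d <= s <= 1 - d -> k <= 1 - cos1 s.
Proof.
move=> /andP[d0 d1].
have h : d <= 1 - d by lra.
have cF : {within `[d, 1 - d], continuous (fun s : R => 1 - cos1 s)}.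
  apply: within_continuousT => x; apply: cvgB; [exact: cvg_cst|exact: continuous_cos1].
have [c] := EVT_min h cF; rewrite in_itv/= => /andP[dc c1] cmin.
exists (1 - cos1 c); last by move=> s sd; apply: cmin; rewrite in_itv.
have -> : cos1 c = 1 - 2 * sin (pi * c) ^+ 2.
  by rewrite /cos1 -mulrA mulr_natl cos_mulr2n -mulr_natr sin2cos2; ring.
suff : 0 < sin (pi * c) by nra.
apply: sin_gt0_pi; have := pi_gt0 R; nra.
Qed.

(** An algebra closed under differentiation: membership alone yields derivatives of all orders, so
    the smoothness of a convolution becomes a matter of algebraic form. *)
Inductive trigpoly (R : realType) : (R -> R) -> Prop :=
| tp_cst a : trigpoly (cst a)
| tp_cos : trigpoly (@cos1 R)
| tp_sin : trigpoly (@sin1 R)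
| tp_add f g : trigpoly f -> trigpoly g -> trigpoly (fun x => f x + g x)
| tp_mul f g : trigpoly f -> trigpoly g -> trigpoly (fun x => f x * g x).

Lemma trigpoly_derive (R : realType) (f : R -> R) : trigpoly f ->
  exists2 f', trigpoly f' & forall x : R, is_derive x 1 f (f' x).
Proof.
elim => [a|||{}f g tf [f' tf' df] tg [g' tg' dg]|{}f g tf [f' tf' df] tg [g' tg' dg]].
- exists (cst 0); [exact: tp_cst|by move=> x; exact: is_derive_cst].
- exists (fun x => - (2 * pi) * sin1 x); last exact: is_derive_cos1.
  by apply: tp_mul; [exact: tp_cst|exact: tp_sin].
- exists (fun x => 2 * pi * cos1 x); last exact: is_derive_sin1.
  by apply: tp_mul; [exact: tp_cst|exact: tp_cos].
- exists (fun x => f' x + g' x); first exact: tp_add.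
  by move=> x; have := df x; have := dg x => ? ?; apply: is_deriveD.
- exists (fun x => f x * g' x + g x * f' x); first by apply: tp_add; apply: tp_mul.
  by move=> x; have := df x; have := dg x => ? ?; apply: is_deriveM.
Qed.

Lemma trigpoly_continuous (R : realType) (f : R -> R) : trigpoly f -> continuous f.
Proof. by move=> /trigpoly_derive[f' _ df]; exact: is_derive_continuous df. Qed.

Lemma trigpoly_smooth (R : realType) (f h : R -> R) (k : nat) :
  trigpoly f -> trigpoly h ->
  exists f' h', [/\ trigpoly f', trigpoly h' &
   derive1n k (fun t => \row_(i < 2) (if i == 0 then f t else h t)) =
   (fun t => \row_(i < 2) (if i == 0 then f' t else h' t))].
Proof.
elim: k f h => [|k ih] f h tf th; first by exists f, h.
have [f' tf' df] := trigpoly_derive tf; have [h' th' dh] := trigpoly_derive th.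
have [f2 [h2 [tf2 th2 E]]] := ih f' h' tf' th'; exists f2, h2; split => //.
rewrite derive1Sn -E; congr derive1n; apply/funext => t.
have drv i j : is_derive t 1 (fun x : R => (\row_(i < 2) (if i == 0 then f x else h x)) i j)
     (if j == 0 then f' t else h' t).
  by rewrite [X in is_derive _ _ X](_ : _ = if j == 0 then f else h);
    [case: ifP|apply/funext => x; rewrite mxE; case: ifP].
rewrite derive1E derive_mx; last first.
  by apply/derivable_mxP => i j; have [] := drv i j.
by apply/matrixP => i j; rewrite !mxE; have [_ ->] := drv i j.
Qed.

Lemma trigpoly_row_derivable (R : realType) (f h : R -> R) (t : R) :
  trigpoly f -> trigpoly h ->
  derivable (fun t => \row_(i < 2) (if i == 0 then f t else h t)) t 1.
Proof.
move=> tf th; apply/derivable_mxP => i j.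
rewrite [X in derivable X](_ : _ = if j == 0 then f else h); last first.
  by apply/funext => x; rewrite mxE; case: ifP.
have [f' _ df] := trigpoly_derive tf; have [h' _ dh] := trigpoly_derive th.
by case: ifP; [have [] := df t|have [] := dh t].
Qed.

(** This is [cos (pi * s) ^+ (2 * n)], the unnormalised de la Vallee Poussin kernel. Its
    concentration at the integers is measured exactly by [mean_kern_cos]. *)
Definition kern (R : realType) (n : nat) (s : R) : R := ((1 + cos1 s) / 2) ^+ n.

Lemma tp_exp (R : realType) (f : R -> R) (n : nat) :
  trigpoly f -> trigpoly (fun x => f x ^+ n).
Proof.
move=> tf; elim: n => [|n ih].
  by rewrite (_ : (fun _ => _) = cst 1); [exact: tp_cst|apply/funext => x; rewrite expr0].
rewrite (_ : (fun _ => _) = (fun x => f x * f x ^+ n)); first exact: tp_mul.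
by apply/funext => x; rewrite exprS.
Qed.

Lemma trigpoly_kern (R : realType) (n : nat) : trigpoly (@kern R n).
Proof.
apply: (@tp_exp R (fun s => (1 + cos1 s) / 2)); apply: tp_mul; last exact: tp_cst.
by apply: tp_add; [exact: tp_cst|exact: tp_cos].
Qed.

Lemma continuous_kern (R : realType) (n : nat) : continuous (@kern R n).
Proof. exact/trigpoly_continuous/trigpoly_kern. Qed.

Lemma kern_ge0 (R : realType) (n : nat) (s : R) : 0 <= kern n s.
Proof.
by apply: exprn_ge0; rewrite divr_ge0// -lerBlDl sub0r cos_geN1.
Qed.

Lemma continuousMf (R : realType) (f g : R -> R) :
  continuous f -> continuous g -> continuous (fun x => f x * g x).
Proof. by move=> cf cg x; apply: cvgM; [exact: cf|exact: cg]. Qed.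

Lemma continuousDf (R : realType) (f g : R -> R) :
  continuous f -> continuous g -> continuous (fun x => f x + g x).
Proof. by move=> cf cg x; apply: cvgD; [exact: cf|exact: cg]. Qed.

Lemma continuousBf (R : realType) (f g : R -> R) :
  continuous f -> continuous g -> continuous (fun x => f x - g x).
Proof. by move=> cf cg x; apply: cvgB; [exact: cf|exact: cg]. Qed.

Lemma continuous_cstf (R : realType) (a : R) : continuous (fun _ : R => a).
Proof. by move=> x; exact: cvg_cst. Qed.

Lemma continuous_shiftf (R : realType) (f : R -> R) (t : R) :
  continuous f -> continuous (fun x => f (x + t)).
Proof.
move=> cf x; apply: continuous_comp; last exact: cf.
by apply: cvgD; [exact: cvg_id|exact: cvg_cst].
Qed.

Ltac ct := lazymatch goal with
  | |- forall x, continuous_at x (fun _ => ?a) => exact: (@continuous_cstf _ a)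
  | |- forall x, continuous_at x (fun s => @?f s * @?g s) => apply: (@continuousMf _ f g); ct
  | |- forall x, continuous_at x (fun s => @?f s - @?g s) => apply: (@continuousBf _ f g); ct
  | |- forall x, continuous_at x (fun s => @?f s + @?g s) => apply: (@continuousDf _ f g); ct
  | |- forall x, continuous_at x (fun s => ?f (s + ?t)) => apply: (@continuous_shiftf _ f t); ct
  | |- _ => first [ assumption | exact: continuous_kern | exact: continuous_cos1
                  | exact: continuous_sin1 ]
  end.

Lemma mean_cst (R : realType) (a : R) : mean (fun _ : R => a) = a.
Proof. by have [|e _ ->//] := @mean_MVT R (fun _ => a); first ct. Qed.

(** Integration by parts: [sin1 * kern n / (2 * pi)] vanishes at [0] and [1], and since
    [sin1 ^+ 2 = (1 - cos1) * (1 + cos1)], its derivative is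
    [kern n - n.+1 * (1 - cos1) * kern n]. *)
Lemma mean_kern_cos (R : realType) (n : nat) :
  mean (fun s : R => (1 - cos1 s) * kern n s) = mean (@kern R n) / n.+1%:R.
Proof.
have d : antider (-1) 2 (fun s : R => (2 * pi)^-1 * (sin1 s * kern n s))
   (fun s => kern n s - n.+1%:R * ((1 - cos1 s) * kern n s)).
  move=> x _.
  have dk : is_derive x 1 (@kern R n)
      (- n%:R * (2 * pi) * (sin1 x / 2 * ((1 + cos1 x) / 2) ^+ n.-1)).
    have d1 : is_derive x 1 (fun s : R => (1 + cos1 s) / 2) (- (2 * pi) * sin1 x / 2).
      rewrite [X in is_derive _ _ X](_ : _ = (fun s : R => 2^-1 *: (1 + cos1 s))); last first.
        by apply/funext => s; rewrite mulrC.
      rewrite [X in is_derive _ _ _ X](_ : _ = 2^-1 *: (0 + (- (2 * pi) * sin1 x))); last first.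
        by rewrite add0r [RHS]mulrC.
      apply: is_deriveZ; apply: is_deriveD; exact: is_derive_cos1.
    have := @is_deriveX R R _ n x 1 _ d1.
    rewrite [X in is_derive _ _ X](_ : _ = @kern R n); last by apply/funext => s; rewrite fctE.
    by move=> h; apply: is_derive_eq h _; rewrite /GRing.scale/=; ring.
  have ds := is_derive_sin1 x.
  have dM := @is_deriveM R R _ _ x 1 _ _ ds dk.
  apply: is_derive_eq (@is_deriveZ R R R _ (2 * pi)^-1 x 1 _ dM) _.
  have pi0 : (pi : R) != 0 by rewrite gt_eqF// pi_gt0.
  have s2 : sin1 x * sin1 x = (1 - cos1 x) * (1 + cos1 x).
    by rewrite -expr2 /sin1 sin2cos2 /cos1; ring.
  rewrite /GRing.scale/=.
    transitivity (cos1 x * kern n x - n%:R * (sin1 x * sin1 x) / 2 * ((1 + cos1 x) / 2) ^+ n.-1).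
    by move: (sin1 x) (kern n x) (cos1 x) (_ ^+ n.-1) (n%:R) (pi : R) pi0 => a b c d e f f0; field; rewrite f0.
  rewrite s2 /kern; case: n {dk dM} => [|n] /=; first by rewrite expr0; ring.
  by rewrite exprS -(natr1 n.+1); field.
have := meanE d.
rewrite meanB; [|ct|ct]; rewrite meanZ; last ct.
have -> : sin1 (1 : R) = 0 by rewrite /sin1 mulr1 mulr_natl sin2pi.
have -> : sin1 (0 : R) = 0 by rewrite /sin1 mulr0 sin0.
rewrite !mul0r mulr0 subr0 => /eqP; rewrite subr_eq0 => /eqP ->.
by rewrite mulrAC divff ?mul1r// pnatr_eq0.
Qed.

(** The mean value theorem gives only nonnegativity, as the kernel can vanish. By [mean_kern_cos],
    passing from [n] to [n.+1] multiplies the mean by [1 - 1 / (2 * n.+1)]. *)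
Lemma mean_kern_gt0 (R : realType) (n : nat) : 0 < mean (@kern R n).
Proof.
elim: n => [|n ih].
  by rewrite (_ : @kern R 0 = fun=> 1) ?mean_cst//; apply/funext => s; rewrite /kern expr0.
have -> : @kern R n.+1 = (fun s => kern n s - 2^-1 * ((1 - cos1 s) * kern n s)).
  by apply/funext => s; rewrite /kern exprS; field.
rewrite meanB; [|ct|ct]; rewrite meanZ ?mean_kern_cos; last ct.
rewrite mulrCA -{1}[mean _]mulr1 -mulrBr mulr_gt0//.
rewrite subr_gt0 -invfM invf_lt1 ?mulr_gt0// -natrM ltr1n; lia.
Qed.

(** * Averages against the kernel, and convolution *)

Definition avg (R : realType) (n : nat) (F : R -> R) : R :=
  mean (fun s => F s * kern n s) / mean (@kern R n).

Lemma avgD (R : realType) n (F G : R -> R) : continuous F -> continuous G ->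
  avg n (fun x => F x + G x) = avg n F + avg n G.
Proof.
move=> cF cG; rewrite /avg -mulrDl -meanD; [|ct|ct].
by congr (mean _ / _); apply/funext => s; rewrite mulrDl.
Qed.

Lemma avgZ (R : realType) n (k : R) (F : R -> R) : continuous F ->
  avg n (fun x => k * F x) = k * avg n F.
Proof.
move=> cF; rewrite /avg mulrA -meanZ; last by ct.
by congr (mean _ / _); apply/funext => s; rewrite mulrA.
Qed.

Lemma avgB (R : realType) n (F G : R -> R) : continuous F -> continuous G ->
  avg n (fun x => F x - G x) = avg n F - avg n G.
Proof.
move=> cF cG; rewrite /avg -mulrBl -meanB; [|ct|ct].
by congr (mean _ / _); apply/funext => s; rewrite mulrBl.
Qed.

Lemma avg_cst (R : realType) n (a : R) : avg n (fun=> a) = a.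
Proof.
rewrite /avg meanZ; last by ct.
by rewrite mulfK// gt_eqF// mean_kern_gt0.
Qed.

Lemma avg_cos (R : realType) n : avg n (fun s : R => 1 - cos1 s) = n.+1%:R^-1.
Proof. by rewrite /avg mean_kern_cos mulrAC divff ?mul1r// gt_eqF// mean_kern_gt0. Qed.

Lemma avg_ge0 (R : realType) n (F : R -> R) : continuous F -> (forall s, 0 <= F s) ->
  0 <= avg n F.
Proof.
move=> cF F0; rewrite /avg divr_ge0//; last exact/ltW/mean_kern_gt0.
by apply: mean_ge0; [ct|move=> s; rewrite mulr_ge0// kern_ge0].
Qed.

(* The weight [1 - cos1] controls the mass that the kernel puts away from the
   integers, so a bound from below that may fail there survives averaging. *)
Lemma avg_ge (R : realType) n (F : R -> R) (a b : R) : continuous F ->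
  (forall s, a - b * (1 - cos1 s) <= F s) -> a - b / n.+1%:R <= avg n F.
Proof.
move=> cF h; rewrite -avg_cos -(avg_cst n a) -avgZ; last by ct.
rewrite -avgB; [|ct|ct].
rewrite -subr_ge0 -avgB; [|ct|ct].
by apply: avg_ge0; [ct|move=> s; rewrite subr_ge0].
Qed.

(** As [kern] is even, this is the convolution with the normalised kernel. Shifting [F] rather than
    the kernel lets bounds on increments of [F] go straight into [avg_ge] and [avg_norm_le]. *)
Definition conv (R : realType) (n : nat) (F : R -> R) (t : R) : R :=
  avg n (fun s => F (s + t)).

(** Once the shift is moved onto the kernel, the formula for [cos1 (s - t)] in one factor separates
    [s] from [t], and [cos1 s] and [sin1 s] are absorbed into the weight; hence the induction over
    all continuous weights [G]. *)
Lemma conv_trigpoly (R : realType) n (F : R -> R) :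
  continuous F -> periodic F 1 -> trigpoly (conv n F).
Proof.
move=> cF pF.
have key m (G : R -> R) : continuous G ->
    trigpoly (fun t => mean (fun s => G s * kern m (s - t))).
  elim: m G => [|m ih] G cG.
    rewrite (_ : (fun _ => _) = cst (mean G)); first exact: tp_cst.
    by apply/funext => t; congr mean; apply/funext => s; rewrite /kern expr0 mulr1.
  have ck t : continuous (fun s : R => kern m (s - t)) by ct.
  rewrite (_ : (fun _ => _) = (fun t => (cst 2^-1 : R -> R) t * (mean (fun s => G s * kern m (s - t)) +
      (cos1 t * mean (fun s => (G s * cos1 s) * kern m (s - t)) +
       sin1 t * mean (fun s => (G s * sin1 s) * kern m (s - t)))))); last first.
    apply/funext => t.
    rewrite [cst _ _]/= -!meanZ; [|ct|ct].
    do 2!(rewrite -meanD; [|ct|ct]).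
    rewrite -meanZ; last by ct.
    congr mean; apply/funext => s; rewrite /kern exprS cos1B; move: (_ ^+ m) => X; by field.
    apply: tp_mul; first exact: tp_cst.
  apply: tp_add; first exact: ih.
  apply: tp_add.
    by apply: (@tp_mul R (@cos1 R)); [exact: tp_cos|apply: ih; ct].
  by apply: (@tp_mul R (@sin1 R)); [exact: tp_sin|apply: ih; ct].
rewrite (_ : conv n F = (fun t => mean (fun s => F s * kern n (s - t)) * (mean (@kern R n))^-1)).
  by apply: (@tp_mul R _ (fun=> (mean (@kern R n))^-1)); [exact: key|exact: tp_cst].
apply/funext => t; rewrite /conv /avg; congr (_ * _).
have ck : continuous (fun s : R => kern n (s - t)) by ct.
rewrite -[RHS](@mean_shift R _ t); first last.
- by move=> s; rewrite pF /kern addrAC periodic_cos1.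
- by ct.
- by congr mean; apply/funext => s; rewrite addrK.
Qed.

Lemma conv_periodic (R : realType) n (F : R -> R) : periodic F 1 -> periodic (conv n F) 1.
Proof. by move=> pF t; congr avg; apply/funext => s; rewrite addrA pF. Qed.

Definition lipschitz_fun (R : realType) (L : R) (F : R -> R) : Prop :=
  forall s t, `|F s - F t| <= L * `|s - t|.

Lemma lipschitz_fun_continuous (R : realType) (L : R) (F : R -> R) :
  lipschitz_fun L F -> continuous F.
Proof.
move=> lF; have L0 : 0 <= L by have := lF 1 0; rewrite subr0 normr1 mulr1; apply: le_trans.
move=> x; apply/cvgrPdist_le => e e0; near=> y.
apply: (le_trans (lF _ _)).
have h : `|x - y| <= e / (L + 1).
  near: y; apply: cvgr_dist_le; first exact: cvg_id.
  by rewrite divr_gt0//; lra.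
have : (L + 1) * `|x - y| <= e by rewrite mulrC -ler_pdivlMr//; lra.
have := normr_ge0 (x - y); nra.
Unshelve. all: by end_near. Qed.

Lemma avg_norm_le (R : realType) n (F : R -> R) (a b : R) : continuous F ->
  (forall s, `|F s| <= a + b * (1 - cos1 s)) -> `|avg n F| <= a + b / n.+1%:R.
Proof.
move=> cF h; rewrite ler_norml.
have h1 : - a - b / n.+1%:R <= avg n F.
  by apply: avg_ge => // s; have := h s; rewrite ler_norml; lra.
have h2 : - a - b / n.+1%:R <= avg n (fun s => -1 * F s).
  apply: avg_ge; first by ct.
  by move=> s; have := h s; rewrite ler_norml; lra.
by move: h1 h2; rewrite avgZ; [move: (b / _) => B; lra|ct].
Qed.

Lemma conv_lipschitz (R : realType) n (F : R -> R) (L : R) :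
  lipschitz_fun L F -> lipschitz_fun L (conv n F).
Proof.
move=> lF s t; have cF := lipschitz_fun_continuous lF.
rewrite /conv -avgB; [|ct|ct].
have := @avg_norm_le R n (fun x => F (x + s) - F (x + t)) (L * `|s - t|) 0.
rewrite !mul0r !addr0; apply; first by ct.
by move=> x; rewrite mul0r addr0 (le_trans (lF _ _))// opprD addrACA subrr add0r.
Qed.

Lemma frac_itv (R : realType) (s : R) : exists k : int, 0 <= s - k%:~R < 1.
Proof. exists (Num.floor s); have := floor_itv s => /andP[]; rewrite intrD; lra. Qed.

(** Turns knowledge near the integers into a bound for all [s]: elsewhere a bounded error is
    dominated by a multiple of [1 - cos1 s], the form expected by [avg_ge] and [avg_norm_le]. *)
Lemma near_int_or_gap (R : realType) (d : R) : 0 < d < 1 / 2 ->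
  exists2 k : R, 0 < k &
   forall s, (exists z : int, `|s - z%:~R| < d) \/ k <= 1 - cos1 s.
Proof.
move=> d01; have [k k0 hk] := cos1_gap d01; exists k => // s.
have [z /andP[z0 z1]] := frac_itv s.
have [h|h] := ltP (s - z%:~R) d; first by left; exists z; rewrite ger0_norm.
have [h2|h2] := ltP (1 - d) (s - z%:~R).
  by left; exists (z + 1); rewrite intrD ltr_norml; lra.
have h3 : d <= s - z%:~R <= 1 - d by rewrite h h2.
right; have := hk _ h3; by rewrite -mulrNz (periodicz _ _ (@periodic_cos1 R)).
Qed.

Lemma inv_nat_small (R : realType) (B e : R) : 0 < e ->
  exists N, forall n, (N <= n)%N -> B / n.+1%:R <= e.
Proof.
move=> e0; have [N hN] : exists N : nat, B / e <= N%:R.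
  by exists (Num.truncn (B / e)).+1; apply/ltW/truncnS_gt.
exists N => n Nn; rewrite ler_pdivrMr ?ltr0n// mulrC -ler_pdivrMr//.
by apply: (le_trans hN); rewrite ler_nat; lia.
Qed.

Lemma conv_close (R : realType) (F : R -> R) (L e : R) :
  lipschitz_fun L F -> periodic F 1 -> 0 < e ->
  exists N, forall n, (N <= n)%N -> forall t, `|conv n F t - F t| <= e.
Proof.
move=> lF pF e0; have cF := lipschitz_fun_continuous lF.
have L0 : 0 <= L by have := lF 1 0; rewrite subr0 normr1 mulr1; apply: le_trans.
pose d : R := Num.min (1 / 4) (e / (2 * (L + 1))).
have d0 : 0 < d by rewrite lt_min; apply/andP; split; [lra|apply: divr_gt0 => //; lra].
have d4 : d <= 1 / 4 by rewrite ge_min lexx.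
have dL : L * d <= e / 2.
  have : d <= e / (2 * (L + 1)) by rewrite ge_min lexx orbT.
  rewrite ler_pdivlMr; last lra.
  by nra.
have d12 : 0 < d < 1 / 2 by apply/andP; split; lra.
have [k k0 hk] := near_int_or_gap d12.
have e2 : 0 < e / 2 by lra.
have [N hN] := inv_nat_small (L / k) e2.
exists N => n Nn t; rewrite -[X in _ - X](avg_cst n) /conv -avgB; [|ct|ct].
apply: (le_trans (@avg_norm_le R n _ (e / 2) (L / k) _ _)).
- by ct.
(* Near an integer the Lipschitz bound gives at most [L * d <= e / 2]. Elsewhere the integer part of
   [s] is dropped by periodicity, so the error is at most [L], which [L / k] times the weight
   covers. *)
- move=> s; have [[z hz]|hs] := hk s.
    rewrite -[X in _ - X](periodicz z t pF) (le_trans (lF _ _))//.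
    have -> : s + t - (t + z%:~R) = s - z%:~R by ring.
    have : L * `|s - z%:~R| <= L * d by rewrite ler_wpM2l// ltW.
    have : 0 <= L / k * (1 - cos1 s).
      by rewrite mulr_ge0// ?subr_ge0 ?cos_le1// divr_ge0// ltW.
    lra.
  have [z /andP[z0 z1]] := frac_itv s.
  rewrite -[X in _ - X](periodicz z t pF) (le_trans (lF _ _))//.
  have -> : s + t - (t + z%:~R) = s - z%:~R by ring.
  have h : L * `|s - z%:~R| <= L by rewrite ger0_norm//; nra.
  have : L <= L / k * (1 - cos1 s) by rewrite mulrAC ler_pdivlMr// ler_wpM2l.
  lra.
- by move: (hN n Nn); move: (L / k / _) => B; lra.
Qed.

(* For [u] fixed, averaging preserves strict monotonicity of [<u, P>] at scales
   below [d] as soon as the kernel is concentrated enough. *)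
Lemma conv_monotone (R : realType) (P Q : R -> R) (L d c : R) :
  lipschitz_fun L P -> lipschitz_fun L Q -> periodic P 1 -> periodic Q 1 -> 0 < d -> 0 < c ->
  exists N, forall n, (N <= n)%N -> forall t u v : R,
    `|u| <= 2 -> `|v| <= 2 ->
    (forall a b, t - d <= a -> a <= b -> b <= t + d ->
       c * (b - a) <= u * (P b - P a) + v * (Q b - Q a)) ->
    forall a b, t - d / 2 <= a -> a <= b -> b <= t + d / 2 ->
       c / 2 * (b - a) <= u * (conv n P b - conv n P a) + v * (conv n Q b - conv n Q a).
Proof.
move=> lP lQ pP pQ d0 c0.
have cP := lipschitz_fun_continuous lP; have cQ := lipschitz_fun_continuous lQ.
have L0 : 0 <= L by have := lP 1 0; rewrite subr0 normr1 mulr1; apply: le_trans.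
(* A shift by less than [d / 2] keeps the window of radius [d / 2] inside the window of radius
   [d]. *)
pose e : R := Num.min (1 / 4) (d / 2).
have e0 : 0 < e by rewrite lt_min; apply/andP; split; lra.
have e4 : e <= 1 / 4 by rewrite ge_min lexx.
have ed : e <= d / 2 by rewrite ge_min lexx orbT.
have e12 : 0 < e < 1 / 2 by apply/andP; split; lra.
have [k k0 hk] := near_int_or_gap e12.
(* Away from the integers the increment is only known to be at least [- 4 * L * (b - a)], as [u] and
   [v] are bounded by [2]. Where [1 - cos1 s >= k], this [B] makes up the difference with
   [c * (b - a)]. *)
pose B := (c + 4 * L) / k.
have c2 : 0 < c / 2 by lra.
have [N hN] := inv_nat_small B c2.
exists N => n Nn t u v u2 v2 mono a b ta ab bt.
pose F s := u * (P (s + b) - P (s + a)) + v * (Q (s + b) - Q (s + a)).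
have cF : continuous F by rewrite /F; ct.
have -> : u * (conv n P b - conv n P a) + v * (conv n Q b - conv n Q a) = avg n F.
  rewrite /F avgD; [|ct|ct]; rewrite !avgZ; [|ct|ct].
  by rewrite !avgB; [|ct|ct|ct|ct].
have B0 : 0 <= B by rewrite divr_ge0//; lra.
apply: (@le_trans _ _ (c * (b - a) - (B * (b - a)) / n.+1%:R)).
  by move: (hN n Nn); rewrite (mulrAC B); move: (B / _) => C; nra.
apply: avg_ge => // s.
have s1 : 0 <= 1 - cos1 s by rewrite subr_ge0 cos_le1.
have ba : 0 <= b - a by rewrite subr_ge0.
have [[z]|hs] := hk s.
  rewrite ltr_norml => /andP[h1 h2].
  have -> : F s = u * (P (s - z%:~R + b) - P (s - z%:~R + a)) +
                  v * (Q (s - z%:~R + b) - Q (s - z%:~R + a)).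
    by rewrite !(addrAC s (- z%:~R)) -mulrNz !(periodicz _ _ pP) !(periodicz _ _ pQ).
  apply: (@le_trans _ _ (c * (b - a))).
    by have := mulr_ge0 (mulr_ge0 B0 ba) s1; lra.
  have -> : b - a = (s - z%:~R + b) - (s - z%:~R + a) by ring.
  by apply: mono; lra.
have hB : c + 4 * L <= B * (1 - cos1 s).
  by rewrite /B mulrAC ler_pdivlMr// ler_wpM2l//; lra.
have hP : `|u * (P (s + b) - P (s + a))| <= 2 * (L * (b - a)).
  rewrite normrM ler_pM// (le_trans (lP _ _))//.
  by rewrite opprD addrACA subrr add0r ger0_norm.
have hQ : `|v * (Q (s + b) - Q (s + a))| <= 2 * (L * (b - a)).
  rewrite normrM ler_pM// (le_trans (lQ _ _))//.
  by rewrite opprD addrACA subrr add0r ger0_norm.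
move: hP hQ; rewrite !ler_norml /F => /andP[hP _] /andP[hQ _].
have : (c + 4 * L) * (b - a) <= B * (1 - cos1 s) * (b - a) by rewrite ler_wpM2r.
lra.
Qed.

(** * Smoothing of locally monotone curves *)

Lemma coord_le_norm (R : realType) (v : 'rV[R]_2) (i : 'I_2) : `|v 0 i| <= `|v|.
Proof.
by rewrite [leRHS]/Num.Def.normr /= mx_normrE; apply/bigmax_geP; right; exists (0, i).
Qed.

Lemma norm_rV_le (R : realType) (v : 'rV[R]_2) (e : R) : 0 <= e ->
  (forall i, `|v 0 i| <= e) -> `|v| <= e.
Proof.
move=> e0 h; rewrite [leLHS]/Num.Def.normr /= mx_normrE; apply: bigmax_le => // -[i j] _ /=.
by rewrite ord1.
Qed.

Lemma enorm_le (R : realType) (v : 'rV[R]_2) : enorm v <= 2 * `|v|.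
Proof.
have -> : 2 * `|v| = Num.sqrt ((2 * `|v|) ^+ 2) by rewrite sqrtr_sqr ger0_norm// mulr_ge0.
rewrite /enorm ler_wsqrtr// big_ord_recl big_ord1.
have h i : v ord0 i ^+ 2 <= `|v| ^+ 2.
  by rewrite -real_normK ?num_real// lerXn2r ?nnegrE// coord_le_norm.
have := h ord0; have := h (lift ord0 ord0).
by rewrite !expr2; have := normr_ge0 v; nra.
Qed.

Lemma norm_le_enorm (R : realType) (v : 'rV[R]_2) : `|v| <= enorm v.
Proof.
apply: norm_rV_le; first exact: sqrtr_ge0.
move=> i; rewrite -sqrtr_sqr /enorm ler_wsqrtr//.
by rewrite (bigD1 i)//= lerDl sumr_ge0// => j _; rewrite sqr_ge0.
Qed.

Lemma jordan_inj (R : realType) (g : R -> 'rV[R]_2) (s t : R) :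
  periodic g 1 -> {in `[0, 1[ &, injective g} -> 0 < t - s < 1 -> g s != g t.
Proof.
move=> pg ig /andP[h0 h1]; apply/eqP => E.
have [k /andP[k0 k1]] := frac_itv s; have [l /andP[l0 l1]] := frac_itv t.
have E' : s - k%:~R = t - l%:~R.
  apply: ig; rewrite ?in_itv/= ?k0 ?l0//.
  by rewrite -!mulrNz !(periodicz _ _ pg).
have : t - s = (l - k)%:~R by rewrite intrB; lra.
move=> E2; move: h0 h1; rewrite E2 ltr0z ltrz1; lia.
Qed.

(** Compactness of the set of pairs [(s, t - s)] with [s] in one period; [d <= 1 / 2] makes it
    nonempty, and halving the minimum gives the strict inequality. *)
Lemma unif_inj (R : realType) (g : R -> 'rV[R]_2) (d : R) :
  jordan_parametrization g -> 0 < d <= 1 / 2 ->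
  exists2 eta : R, 0 < eta & forall s t, d <= t - s <= 1 - d -> eta < `|g s - g t|.
Proof.
move=> [pg cg ig] /andP[d0 d1].
pose A := (`[0, 1] `*` `[d, 1 - d])%classic : set (R * R).
have cA : compact A by apply: compact_setX; exact: segment_compact.
have A0 : A !=set0 by exists (0, d); split => /=; rewrite in_itv/=; apply/andP; split; lra.
pose f (x : R * R) := `|g x.1 - g (x.1 + x.2)|.
have cf : {within A, continuous f}.
  apply: continuous_subspaceT => x; apply: cvg_norm; apply: cvgB.
    by apply: continuous_comp; [exact: cvg_fst|exact: cg].
  apply: continuous_comp; last exact: cg.
  by apply: cvgD; [exact: cvg_fst|exact: cvg_snd].
have [[x y] xyA hmin] := compact_EVT_min A0 cA cf.
move: xyA; rewrite inE => -[/=]; rewrite !in_itv/= => /andP[x0 x1] /andP[y0 y1].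
exists (f (x, y) / 2).
  rewrite divr_gt0// normr_gt0 subr_eq0 /=; apply: jordan_inj => //.
  by apply/andP; split; lra.
move=> s t /andP[h0 h1]; have [k /andP[k0 k1]] := frac_itv s.
have : f (x, y) <= f (s - k%:~R, t - s).
  apply: hmin; rewrite inE; split => /=; rewrite in_itv/=; apply/andP; split; lra.
have -> : f (s - k%:~R, t - s) = `|g s - g t|.
  rewrite /f /=; have -> : s - k%:~R + (t - s) = t - k%:~R by ring.
  by rewrite -!mulrNz !(periodicz _ _ pg).
have : 0 < f (x, y).
  rewrite normr_gt0 subr_eq0 /=; apply: jordan_inj => //.
  by apply/andP; split; lra.
by move: (f _) (`|_|) => a b; lra.
Qed.

Lemma is_derive_incr_ge0 (R : realType) (h : R -> R) (t r D : R) : 0 < r ->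
  (forall x : R, exists D', is_derive x 1 h D') ->  is_derive t 1 h D ->
  (forall a b, t - r <= a -> a < b -> b <= t + r -> h a < h b) -> 0 <= D.
Proof.
move=> r0 dh ht mono; have [_ <-] := ht; rewrite -derive1E.
apply: (@incr_derive1_ge0_itv R h false false (t - r) (t + r)).
- by move=> x _; have [D' []] := dh x.
- move=> x y; rewrite !in_itv/= => /andP[x1 x2] /andP[y1 y2] xy; apply: mono => //; lra.
- by rewrite in_itv/=; apply/andP; split; lra.
Qed.

(** A quantitative form of immersion that makes sense at the corners of a polygon: the direction
    [(u, v)] depends on [t], the constants do not. The bound [2] is the one satisfied by a sum of
    two unit lattice steps. *)
Definition locally_monotone (R : realType) (d c : R) (P : R -> 'rV[R]_2) : Prop :=
  forall t, exists u v : R, [/\ `|u| <= 2, `|v| <= 2 &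
    forall a b, t - d <= a -> a <= b -> b <= t + d ->
      c * (b - a) <= u * (P b 0 0 - P a 0 0) + v * (P b 0 1 - P a 0 1)].

Lemma smoothing (R : realType) (P : R -> 'rV[R]_2) (L d c e : R) :
  periodic P 1 -> {in `[0, 1[ &, injective P} ->
  (forall i, lipschitz_fun L (fun t => P t 0 i)) ->
  0 < d -> 0 < c -> locally_monotone d c P -> 0 < e ->
  exists g, [/\ smooth_jordan_embedding g, (forall t, `|g t - P t| <= e) &
    forall i, lipschitz_fun L (fun t => g t 0 i)].
Proof.
move=> pP iP lP d0 c0 mP e0.
have cPi i := lipschitz_fun_continuous (lP i).
have cP : continuous P.
  move=> t; apply/cvgrPdist_le => r r0; near=> s.
  apply: norm_rV_le; first exact: ltW.
  near: s; apply: filter_forall => i.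
  have /cvgrPdist_le/(_ r r0) := cPi i t.
  by apply: filterS => s; rewrite !mxE.
have pPi i : periodic (fun t => P t 0 i) 1 by move=> t; rewrite pP.
pose r : R := Num.min (1 / 2) (d / 2).
have r0 : 0 < r by rewrite lt_min; apply/andP; split; lra.
have r2 : r <= 1 / 2 by rewrite ge_min lexx.
have rd : r <= d / 2 by rewrite ge_min lexx orbT.
have r12 : 0 < r <= 1 / 2 by rewrite r0 r2.
have [eta eta0 heta] := unif_inj (And3 pP cP iP) r12.
(* Two points moved by at most [eta / 2] each cannot close a gap strictly larger than [eta]. *)
have e1 : 0 < Num.min e (eta / 2) by rewrite lt_min e0 divr_gt0.
have [N0 hN0] := conv_close (lP 0) (pPi 0) e1.
have [N1 hN1] := conv_close (lP 1) (pPi 1) e1.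
have [N2 hN2] := conv_monotone (lP 0) (lP 1) (pPi 0) (pPi 1) d0 c0.
have [n [n0 n1 n2]] : exists n, [/\ (N0 <= n)%N, (N1 <= n)%N & (N2 <= n)%N].
  by exists (N0 + N1 + N2)%N; split; clear; lia.
pose f i := conv n (fun t => P t 0 i).
have tf i : trigpoly (f i) by apply: conv_trigpoly.
pose g : R -> 'rV[R]_2 := fun t => \row_(i < 2) (if i == 0 then f 0 t else f 1 t).
have gE t i : g t 0 i = f i t.
  by rewrite mxE; case: eqP => [->//|/eqP i0]; congr (f _ t); apply/val_inj; case: i i0 => [[|[|]]].
have close t : `|g t - P t| <= Num.min e (eta / 2).
  apply: norm_rV_le; first exact: ltW.
  move=> i; rewrite !mxE.
  have := gE t i; rewrite mxE => ->.
  have [->|i0] := eqVneq i 0; first exact: hN0.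
  have -> : i = 1 by apply/val_inj; case: i i0 => [[|[|]]].
  exact: hN1.
have pg : periodic g 1.
  by move=> t; apply/rowP => i; rewrite !gE /f (conv_periodic n (pPi i)).
have mono t : exists u v : R, forall a b, t - r <= a -> a <= b -> b <= t + r ->
    c / 2 * (b - a) <= u * (f 0 b - f 0 a) + v * (f 1 b - f 1 a).
  have [u [v [u2 v2 huv]]] := mP t; exists u, v => a b h1 h2 h3.
  have ha : t - d / 2 <= a by lra.
  have hb : b <= t + d / 2 by lra.
  exact: (hN2 n n2 t u v u2 v2 huv a b ha h2 hb).
have injg s t : 0 < t - s < 1 -> g s != g t.
  move=> /andP[h0 h1]; apply/eqP => E.
  have near a b : 0 < b - a <= r -> g a <> g b.
    move=> /andP[h2 h3] E'; have [u [v huv]] := mono a.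
    have := huv a b; rewrite -!gE E' !subrr !mulr0 addr0 => h.
    have : c / 2 * (b - a) <= 0 by apply: h; lra.
    by have : 0 < c / 2 * (b - a); [apply: mulr_gt0; lra|lra].
  have [h2|h2] := leP (t - s) r; first by apply: (near s t) => //; rewrite h0.
  (* Times almost a full period apart are close on the circle: [t] is compared with [s + 1]. *)
  have [h3|h3] := leP (1 - r) (t - s).
    apply: (near t (s + 1)); last by rewrite pg.
    by apply/andP; split; lra.
  have := heta s t; have -> : r <= t - s <= 1 - r by apply/andP; split; lra.
  move=> /(_ isT); rewrite ltNge => /negP; apply.
  have -> : P s - P t = (P s - g s) + (g t - P t) by rewrite E addrA subrK.
  apply: (le_trans (ler_normD _ _)); rewrite distrC.
  have := close s; have := close t; rewrite !le_min => /andP[_ H1] /andP[_ H2].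
  by move: H1 H2; move: (`|_|) (`|_|) => x y; lra.
exists g; split.
- split => //.
  + move=> k t; have [f' [h' [tf' th' E]]] := trigpoly_smooth k (tf 0) (tf 1).
    by rewrite E; exact: trigpoly_row_derivable.
  + move=> s t; rewrite !in_itv/= => /andP[s0 s1] /andP[t0 t1] E.
    have [st|ts|//] := ltgtP s t.
      by have := injg s t; rewrite E eqxx => h; have : false by apply: h; apply/andP; split; lra.
    by have := injg t s; rewrite E eqxx => h; have : false by apply: h; apply/andP; split; lra.
  + move=> t; apply/eqP => E.
    have [f0 tf0 df0] := trigpoly_derive (tf 0); have [f1 tf1 df1] := trigpoly_derive (tf 1).
    have dg : derivable g t 1 by exact: trigpoly_row_derivable.
    have E0 i : 'D_1 (f i) t = 0.
      have := derive_mx dg; rewrite -derive1E E => /matrixP/(_ 0 i).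
      rewrite 2!mxE => ->; congr (derive _ t 1); apply/funext => s.
      by rewrite -[LHS]gE.
    have [u [v huv]] := mono t.
    (* If both derivatives vanish at [t], this function has derivative [- c / 4] there; yet it
       increases near [t], since the rate [c / 2] exceeds [c / 4]. *)
    have := @is_derive_incr_ge0 R (fun s => u * f 0 s + v * f 1 s - c / 4 * s) t r
       (u * 0 + v * 0 - c / 4 * 1) r0.
    have dd (y d0' d1' : R) : is_derive y 1 (f 0) d0' -> is_derive y 1 (f 1) d1' ->
       is_derive y 1 (fun s => u * f 0 s + v * f 1 s - c / 4 * s) (u * d0' + v * d1' - c / 4 * 1).
      by move=> k0 k1; apply: is_deriveB.
    have h1 : forall x : R, exists D',
        is_derive x 1 (fun s => u * f 0 s + v * f 1 s - c / 4 * s) D'.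
      by move=> x; eexists; apply: dd.
    move=> /(_ h1); have h3 : is_derive t 1 (fun s => u * f 0 s + v * f 1 s - c / 4 * s)
       (u * 0 + v * 0 - c / 4 * 1).
      have k0 : is_derive t 1 (f 0) 0 by rewrite -(E0 0); have [k _] := df0 t; exact: DeriveDef.
      have k1 : is_derive t 1 (f 1) 0 by rewrite -(E0 1); have [k _] := df1 t; exact: DeriveDef.
      exact: dd.
    move=> /(_ h3) h4; suff : 0 <= u * 0 + v * 0 - c / 4 * 1 by lra.
    apply: h4 => a b ha ab hb; have := huv a b ha (ltW ab) hb.
    have : 0 < c * (b - a) by apply: mulr_gt0; lra.
    move: (f 0 b) (f 0 a) (f 1 b) (f 1 a) => x0 x1 y0 y1; nra.
- by move=> t; have := close t; rewrite le_min => /andP[].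
- move=> i s t; rewrite !gE; exact: conv_lipschitz.
Unshelve. all: by end_near. Qed.

(** * Loop erasure *)

(* [w] lists the vertices and [s] the times of a closed walk with [m] edges;
   edge [i] runs from [w i] to [w (i + 1)] and is traversed at the single time
   [s i], at which both of its ends are close to the curve. *)
Definition closed_walk (R : realType) (V : Type) (near : V -> R -> Prop)
    (adj : V -> V -> Prop) (m : nat) (w : int -> V) (s : int -> R) : Prop :=
  [/\ (0 < m)%N, forall i, w (i + m%:Z) = w i, forall i, s (i + m%:Z) = s i + 1,
    forall i, 0 < s (i + 1) - s i < 1 / 2 &
    forall i, [/\ near (w i) (s i), near (w (i + 1)) (s i) & adj (w i) (w (i + 1))]].

Lemma modz_succ (j : int) (n : nat) : (0 < n)%N ->
  (((j + 1) %% n)%Z = (j %% n)%Z + 1 /\ ((j + 1) %/ n)%Z = (j %/ n)%Z) \/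
  [/\ (j %% n)%Z = n%:Z - 1, ((j + 1) %% n)%Z = 0 & ((j + 1) %/ n)%Z = (j %/ n)%Z + 1].
Proof.
move=> n0; have nz : n%:Z != 0 by lia.
have r0 := modz_ge0 j nz; have r1 : (j %% n < n)%Z by rewrite ltz_pmod; lia.
have jE := divz_eq j n; move: (j %/ n)%Z (j %% n)%Z r0 r1 jE => q r r0 r1 ->.
rewrite -addrA modzMDl divzMDl//.
have [h|h] := ltP (r + 1) n%:Z.
  by left; rewrite modz_small ?divz_small; [split; lia|lia|lia].
have -> : r + 1 = 1 * n%:Z + 0 by lia.
by right; rewrite modzMDl divzMDl// mod0z div0z; split; lia.
Qed.

Section LoopErasure.
Variables (R : realType) (V : Type) (near : V -> R -> Prop) (adj : V -> V -> Prop).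
Hypothesis near_periodic : forall v t (k : int), near v t -> near v (t + k%:~R).

(** The edges from [i] to [i + n - 1] are repeated forever, lap [j %/ n] being delayed by that many
    periods. Only the time step across the seam is new, hence the last hypothesis. *)
Lemma sub_walk (m : nat) (w : int -> V) (s : int -> R) (i : int) (n : nat) :
  closed_walk near adj m w s -> (0 < n)%N -> w (i + n%:Z) = w i ->
  0 < s i + 1 - s (i + n%:Z - 1) < 1 / 2 ->
  exists w' s', closed_walk near adj n w' s'.
Proof.
move=> [m0 pw ps gap edge] n0 wE sE.
exists (fun j => w (i + (j %% n)%Z)), (fun j => s (i + (j %% n)%Z) + (j %/ n)%Z%:~R).
split => // j.
- by rewrite modzDr.
- have -> : ((j + n) %% n)%Z = (j %% n)%Z by rewrite modzDr.
  have -> : ((j + n) %/ n)%Z = (j %/ n)%Z + 1 by rewrite divzDr// divzz; congr (_ + _); lia.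
  by rewrite intrD addrA.
- case: (modz_succ j n0) => [[-> ->]|[E -> ->]].
    by have := gap (i + (j %% n)%Z); rewrite -addrA; lra.
  by move: sE; rewrite E addr0 intrD (addrA i); lra.
- have [h1 h2 h3] := edge (i + (j %% n)%Z).
  suff -> : w (i + ((j + 1) %% n)%Z) = w (i + (j %% n)%Z + 1) by split => //; exact: near_periodic.
  case: (modz_succ j n0) => [[-> _]|[-> -> _]]; first by rewrite addrA.
  by rewrite addr0 -wE; congr w; ring.
Qed.

Lemma loop_erasure (m : nat) (w : int -> V) (s : int -> R) (d : R) :
  d <= 1 / 6 ->
  (forall v a b, near v a -> near v b -> 0 <= b - a <= 1 -> b - a < d \/ 1 - d < b - a) ->
  closed_walk near adj m w s ->
  exists m' w' s', closed_walk near adj m' w' s' /\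
    forall i j, w' i = w' j -> (m'%:Z %| i - j)%Z.
Proof.
move=> d6 sep; elim/ltn_ind: m w s => m ih w s cw.
have [inj|] := pselect (forall i j, w i = w j -> (m%:Z %| i - j)%Z).
  by exists m, w, s.
move=> /existsNP[i /existsNP[j /not_implyP[wij nd]]].
have [m0 pw ps gap edge] := cw.
pose n := `|((j - i) %% m)%Z|%N.
have mz : m%:Z != 0 by lia.
have r0 := modz_ge0 (j - i) mz; have r1 : ((j - i) %% m < m)%Z by rewrite ltz_pmod; lia.
have rz : ((j - i) %% m)%Z <> 0.
  by move=> /dvdz_mod0P h; apply: nd; rewrite -opprB rpredN.
have nE : n%:Z = ((j - i) %% m)%Z by rewrite /n; lia.
have n0 : (0 < n)%N by rewrite /n; lia.
have nm : (n < m)%N by rewrite /n; lia.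
have pwz k l : w (k + l * m%:Z) = w k.
  have pwn (q : nat) k' : w (k' + q%:Z * m%:Z) = w k'.
    elim: q k' => [|q IH] k'; first by rewrite mul0r addr0.
    by rewrite intS mulrDl mul1r addrA IH pw.
  case: l => q; first exact: pwn.
  by rewrite NegzE -(pwn q.+1) mulNr subrK.
have wn : w (i + n%:Z) = w i.
  by rewrite nE wij -(pwz _ ((j - i) %/ m)%Z); congr w; rewrite -[RHS](subrK i) {3}(divz_eq (j - i) m); ring.
pose b := i + n%:Z.
have inc k (q : nat) : s k <= s (k + q%:Z).
  elim: q => [|q IH]; first by rewrite addr0.
  by apply: (le_trans IH); have := gap (k + q%:Z); rewrite intS (addrC 1) addrA; lra.
(* Vertex [k + 1] is the head of edge [k] and the tail of edge [k + 1], hence near at both times;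
   the alternative [1 - d] contradicts the bound [1 / 2] on steps. *)
have gapd k : s (k + 1) - s k < d.
  have [h1 h2 _] := edge k; have [h3 _ _] := edge (k + 1).
  have := gap k; have := sep _ _ _ h2 h3; move: (s (k + 1)) (s k) => x y; lra.
have short1 : s i + 1 - s (b - 1) < 1 / 2 -> exists w' s', closed_walk near adj n w' s'.
  move=> h; apply: (sub_walk cw n0 wn); rewrite -/b h andbT subr_gt0 -ps.
  have := inc b (m - n)%N; have := gap (b - 1); rewrite subrK /b.
  have -> : i + n%:Z + (m - n)%N%:Z = i + m%:Z by lia.
  lra.
have mn0 : (0 < m - n)%N by lia.
have bm : b + (m - n)%N%:Z = i + m%:Z by rewrite /b; lia.
have short2 : s b - s (i - 1) < 1 / 2 -> exists w' s', closed_walk near adj (m - n) w' s'.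
  move=> h; apply: (@sub_walk _ _ _ b _ cw mn0); first by rewrite bm pw /b wn.
  have -> : b + (m - n)%N%:Z - 1 = i - 1 + m%:Z by rewrite bm; ring.
  rewrite ps; have := inc i n; have := gap (i - 1); rewrite subrK -/b.
  move: h; lra.
have [h|h] := ltP (s b - s (i - 1)) (1 / 2).
  have [w' [s' cw']] := short2 h; apply: ih cw'; lia.
have [w' [s' cw']] : exists w' s', closed_walk near adj n w' s'; last exact: ih cw'.
apply: short1.
(* The stretch from [i - 1] to [b] takes at least half a period, so more than [1 - d] by separation.
   Removing its two extreme steps, each below [d], leaves more than [1 - 3 * d]. *)
have [_ h1 _] := edge (i - 1); have [h2 _ _] := edge b; rewrite subrK in h1.
rewrite /b wn -/b in h2.
have h3 : 0 <= s b - s (i - 1) <= 1.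
  have := inc b (m - n)%N; rewrite bm ps; have := gap (i - 1); rewrite subrK.
  have := inc i n; rewrite -/b.
  have := inc b (m - n).-1; have -> : b + (m - n).-1%:Z = i - 1 + m%:Z by move: bm; lia.
  by rewrite ps; lra.
have := sep _ _ _ h1 h2 h3; have := gapd (i - 1); have := gapd (b - 1); rewrite !subrK.
lra.
Qed.

End LoopErasure.

(** * Lattice walks *)

Definition interp (R : realType) (f : int -> R) (x : R) : R :=
  let j := Num.floor x in f j + (x - j%:~R) * (f (j + 1) - f j).

Lemma interp_cell (R : realType) (f : int -> R) (j : int) (x : R) :
  j%:~R <= x <= j%:~R + 1 -> interp f x = f j + (x - j%:~R) * (f (j + 1) - f j).
Proof.
move=> /andP[jx]; rewrite le_eqVlt => /predU1P[xj|xj].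
  have -> : interp f x = f (j + 1).
    have E : Num.floor x = j + 1 by rewrite xj -[1]/(1%:~R : R) -intrD intrKfloor.
    by rewrite /interp E xj intrD subrr mul0r addr0.
  by rewrite xj; ring.
have E : Num.floor x = j by apply: floor_def; rewrite intrD jx xj.
by rewrite /interp E.
Qed.

Lemma interp_int (R : realType) (f : int -> R) (j : int) : interp f j%:~R = f j.
Proof. by rewrite (@interp_cell _ _ j) ?subrr ?mul0r ?addr0// lexx lerDl ler01. Qed.

Lemma interp_lin (R : realType) (f g : int -> R) (u v x : R) :
  interp (fun j => u * f j + v * g j) x = u * interp f x + v * interp g x.
Proof. by rewrite /interp; ring. Qed.

Lemma interp_shift (R : realType) (f : int -> R) (m : int) (r x : R) :
  (forall j, f (j + m) = f j + r) -> interp f (x + m%:~R) = interp f x + r.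
Proof.
move=> fm; rewrite /interp floorDrz ?intr_int// intrKfloor.
have -> : Num.floor x + m + 1 = Num.floor x + 1 + m by rewrite addrAC.
by rewrite !fm intrD; ring.
Qed.

Lemma nondecreasing_steps (R : realType) (g : int -> R) (i k : int) :
  (forall j, i <= j -> j < k -> g j <= g (j + 1)) ->
  forall p q, i <= p -> p <= q -> q <= k -> g p <= g q.
Proof.
move=> gi p q ip pq qk.
have -> : q = p + `|q - p|%N%:Z by lia.
have : p + `|q - p|%N%:Z <= k by lia.
elim: `|q - p|%N => [|n IH] h; first by rewrite addr0.
apply: (le_trans (IH _)); first by lia.
by rewrite intS (addrC 1) addrA; apply: gi; lia.
Qed.

(** Subtracting [a * x] reduces to a nondecreasing interpolation. Slopes are controlled only between
    [i] and [k], so [y = k], whose floor is the uncontrolled cell [k], is treated apart. *)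
Lemma interp_ge (R : realType) (f : int -> R) (a : R) (i k : int) (x y : R) :
  (forall j, i <= j < k -> a <= f (j + 1) - f j) ->
  i%:~R <= x -> x <= y -> y <= k%:~R -> a * (y - x) <= interp f y - interp f x.
Proof.
move=> fa ix xy yk.
pose g j := f j - a * j%:~R.
have gE z : interp g z = interp f z - a * z.
  by rewrite /interp /g intrD; ring.
suff : interp g x <= interp g y by rewrite !gE; lra.
have gi := @nondecreasing_steps R g i k; have {gi}gi : forall p q, i <= p -> p <= q -> q <= k -> g p <= g q.
  apply: gi => j ij jk; have := fa j; rewrite ij jk => /(_ isT).
  by rewrite /g intrD; lra.
have [x0 x1] := andP (floor_itv x); have [y0 y1] := andP (floor_itv y).
set p := Num.floor x in x0 x1; set q := Num.floor y in y0 y1.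
have pq : p <= q by exact: le_floor.
have ip : i <= p by rewrite floor_ge_int.
have qk : q <= k by rewrite -(ler_int R); lra.
have cx : p%:~R <= x <= p%:~R + 1 by rewrite x0 ltW//; move: x1; rewrite intrD.
have cy : q%:~R <= y <= q%:~R + 1 by rewrite y0 ltW//; move: y1; rewrite intrD.
rewrite (interp_cell g cx) (interp_cell g cy).
have [E|pq'] := eqVneq p q.
  rewrite E lerD2l; have [h|h] := ltP q k.
    by apply: ler_wpM2r; [rewrite subr_ge0; apply: gi; rewrite ?lezD1// ?lerDl// -E|lra].
  have yq : y = x.
    have : k%:~R <= q%:~R :> R by rewrite ler_int.
    by move: x0; rewrite E; lra.
  by rewrite yq.
have pq1 : p + 1 <= q by rewrite lezD1 lt_neqAle pq' pq.
have h1 : g (p + 1) <= g q by apply: gi => //; apply: (le_trans ip); rewrite lerDl.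
apply: (@le_trans _ _ (g (p + 1))).
  have : g p <= g (p + 1) by apply: gi => //; [rewrite lerDl|exact: le_trans pq1 qk].
  move: cx => /andP[cx1 cx2]; move: (g p) (g (p + 1)) => u v uv; nra.
apply: (le_trans h1); rewrite lerDl; have [h|h] := ltP q k.
  apply: mulr_ge0; first lra.
  by rewrite subr_ge0; apply: gi; rewrite ?lezD1// ?lerDl// (le_trans ip).
have -> : y = q%:~R.
  have : k%:~R <= q%:~R :> R by rewrite ler_int.
  lra.
by rewrite subrr mul0r.
Qed.

Lemma interp_lipschitz (R : realType) (f : int -> R) (L : R) :
  (forall j, `|f (j + 1) - f j| <= L) -> lipschitz_fun L (interp f).
Proof.
move=> fL.
have key x y : x <= y -> `|interp f y - interp f x| <= L * (y - x).
  move=> xy; have [x0 _] := andP (floor_itv x); have [_ y1] := andP (floor_itv y).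
  have h1 := @interp_ge R f (- L) _ _ _ _ _ x0 xy (ltW y1).
  (* Negation is spelled as a linear combination so that [interp_lin] applies. *)
  have h2 := @interp_ge R (fun j => -1 * f j + 0 * f j) (- L) _ _ _ _ _ x0 xy (ltW y1).
  rewrite ler_norml; have : - L * (y - x) <= interp f y - interp f x.
    by apply: h1 => j _; have := fL j; rewrite ler_norml => /andP[].
  have : - L * (y - x) <= - interp f y + interp f x.
    move: h2; rewrite !interp_lin !mul0r !addr0 !mulN1r opprK; apply => j _.
    by have := fL j; rewrite ler_norml => /andP[]; lra.
  lra.
move=> s t; have [h|h] := leP s t.
  by rewrite distrC (distrC s) [X in _ * X]ger0_norm ?subr_ge0// key.
by rewrite [X in _ * X]ger0_norm ?subr_ge0 ?(ltW h)// key// ltW.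
Qed.

Lemma unit_step (a b : int) : `|a| + `|b| = 1 ->
  exists e, (e = 1 \/ e = -1) /\ ((a = e /\ b = 0) \/ (a = 0 /\ b = e)).
Proof.
move=> h; have : (a == 1) && (b == 0) || (a == -1) && (b == 0) ||
  (a == 0) && (b == 1) || (a == 0) && (b == -1) by lia.
move=> /orP[/orP[/orP[]|]|] /andP[/eqP -> /eqP ->].
- by exists 1; split; left.
- by exists (-1); split; [right|left].
- by exists 1; split; [left|right].
- by exists (-1); split; right.
Qed.

Lemma int_itv0 (R : realType) (z : int) : -1 < (z%:~R : R) < 1 -> z = 0.
Proof. by rewrite -[1]/(1%:~R : R) -mulrNz !ltr_int => h; lia. Qed.

Lemma edges_meet_parallel (R : realType) (A B e f : int) (s r : R) :
  0 <= s < 1 -> 0 <= r < 1 -> (e = 1 \/ e = -1) -> (f = 1 \/ f = -1) ->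
  A%:~R + s * e%:~R = r * f%:~R -> B%:~R = 0 :> R ->
  [/\ A = 0, B = 0 & s = r] \/ [/\ A = - e, B = 0 & f = - e].
Proof.
move=> s01 r01 he hf hA /eqP; rewrite intr_eq0 => /eqP ->.
have [A0|A0] := eqVneq A 0.
  move: hA; rewrite A0 mulr0z add0r.
  by case: he => ->; case: hf => ->; rewrite ?mulr1z ?mulrN1z => hA; left; split => //; lra.
right; case: he hf hA => -> [] ->; rewrite ?mulr1z ?mulrN1z => hA.
- by case/eqP: A0; apply: (@int_itv0 R); lra.
- split => //; have : -2 < (A%:~R : R) < 1 by lra.
  by rewrite -[2]/(2%:~R : R) -[1]/(1%:~R : R) -!mulrNz !ltr_int => h; lia.
- split => //; have : -1 < (A%:~R : R) < 2 by lra.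
  by rewrite -[2]/(2%:~R : R) -[1]/(1%:~R : R) -!mulrNz !ltr_int => h; lia.
- by case/eqP: A0; apply: (@int_itv0 R); lra.
Qed.

Lemma edges_meet_cross (R : realType) (A B e f : int) (s r : R) :
  0 <= s < 1 -> 0 <= r < 1 -> (e = 1 \/ e = -1) -> (f = 1 \/ f = -1) ->
  A%:~R + s * e%:~R = 0 -> B%:~R = r * f%:~R -> [/\ A = 0, B = 0 & s = r].
Proof.
move=> s01 r01 he hf hA hB.
have A0 : A = 0.
  by apply: (@int_itv0 R); case: he hA => ->; rewrite ?mulr1z ?mulrN1z; lra.
have B0 : B = 0.
  by apply: (@int_itv0 R); case: hf hB => ->; rewrite ?mulr1z ?mulrN1z; lra.
split => //; move: hA hB; rewrite A0 B0 mulr0z.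
by case: he => ->; case: hf => ->; rewrite ?mulr1z ?mulrN1z; lra.
Qed.

(** Since [s] and [r] are below [1], an edge owns its tail but not its head. So edges that merely
    touch share their tail, and an overlap is one edge run in the same or in the opposite sense. *)
Lemma lattice_edges_meet (R : realType) (A B a b a' b' : int) (s r : R) :
  `|a| + `|b| = 1 -> `|a'| + `|b'| = 1 -> 0 <= s < 1 -> 0 <= r < 1 ->
  A%:~R + s * a%:~R = r * a'%:~R -> B%:~R + s * b%:~R = r * b'%:~R ->
  [/\ A = 0, B = 0 & s = r] \/ [/\ A = - a, B = - b, a' = - a & b' = - b].
Proof.
move=> /unit_step[e [he ab]] /unit_step[f [hf ab']] s01 r01.
case: ab ab' => -[-> ->] [] [-> ->]; rewrite ?mulr0z ?mulr0 ?addr0 ?oppr0 => hA hB.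
- by have [[]|[]] := edges_meet_parallel s01 r01 he hf hA hB; [left|right].
- by have [] := edges_meet_cross s01 r01 he hf hA hB; left.
- by have [] := edges_meet_cross s01 r01 he hf hB hA; left.
- by have [[]|[]] := edges_meet_parallel s01 r01 he hf hB hA; [left|right].
Qed.

(** Standing still is allowed, since rounding may leave a vertex unchanged; injectivity excludes it
    later, in [walk_unit_step]. *)
Definition int_adj (v v' : int * int) : Prop := `|v'.1 - v.1| + `|v'.2 - v.2| <= 1.

Section LatticeWalk.
Variables (R : realType) (m : nat) (w : int -> int * int).
Hypothesis m3 : (2 < m)%N.
Hypothesis w_adj : forall i, int_adj (w i) (w (i + 1)).
Hypothesis w_inj : forall i j, w i = w j -> (m%:Z %| i - j)%Z.

Let X i : R := (w i).1%:~R.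
Let Y i : R := (w i).2%:~R.

Lemma not_dvd (k : int) : 0 < `|k| < m%:Z -> ~ (m%:Z %| k)%Z.
Proof. by move=> /andP[k0 km] /dvdzP[q]; have [->|] := eqVneq q 0; nia. Qed.

Lemma walk_unit_step i : `|(w (i + 1)).1 - (w i).1| + `|(w (i + 1)).2 - (w i).2| = 1.
Proof.
have := w_adj i; rewrite /int_adj.
have : w (i + 1) <> w i.
  move=> /w_inj; have -> : i + 1 - i = 1 by ring.
  by apply: not_dvd; move: m3; clear; lia.
case: (w (i + 1)) => a b; case: (w i) => c d /= h.
have : ~~ ((a == c) && (b == d)) by apply/negP => /andP[/eqP ea /eqP eb]; apply: h; rewrite ea eb.
by lia.
Qed.

(** Edges with a common tail agree modulo [m] by [w_inj]. An edge also run backwards would make [m]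
    divide [2]: here three edges are needed, as a walk of two edges goes back and forth on one
    segment. *)
Lemma interp_walk_inj x y : interp X x = interp X y -> interp Y x = interp Y y ->
  `|x - y| < m%:R -> x = y.
Proof.
move=> hX hY hxy; have [x0 x1] := andP (floor_itv x); have [y0 y1] := andP (floor_itv y).
move: hX hY; rewrite /interp /X /Y.
set i := Num.floor x in x0 x1 *; set k := Num.floor y in y0 y1 *.
rewrite intrD in x1; rewrite intrD in y1.
rewrite -!intrB => hX hY.
have sx : 0 <= x - i%:~R < 1 by apply/andP; split; lra.
have sy : 0 <= y - k%:~R < 1 by apply/andP; split; lra.
have hX' : ((w i).1 - (w k).1)%:~R + (x - i%:~R) * ((w (i + 1)).1 - (w i).1)%:~R
   = (y - k%:~R) * ((w (k + 1)).1 - (w k).1)%:~R by rewrite intrB; lra.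
have hY' : ((w i).2 - (w k).2)%:~R + (x - i%:~R) * ((w (i + 1)).2 - (w i).2)%:~R
   = (y - k%:~R) * ((w (k + 1)).2 - (w k).2)%:~R by rewrite intrB; lra.
have [[/eqP e1 /eqP e2 e3]|[e1 e2 e3 e4]] :=
    lattice_edges_meet (walk_unit_step i) (walk_unit_step k) sx sy hX' hY'.
  have E : w i = w k.
    by move: e1 e2; rewrite !subr_eq0; case: (w i) (w k) => [a b] [c d] /= /eqP -> /eqP ->.
  have /dvdzP[q qE] := w_inj E.
  have xy : x - y = q%:~R * m%:R by rewrite -[m%:R]/(m%:Z%:~R) -intrM -qE intrB; lra.
  have q0 : q = 0.
    move: hxy; rewrite xy normrM normr_nat gtr_pMl ?ltr0n; last lia.
    by rewrite -intr_norm ltrz1; lia.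
  by move: xy; rewrite q0 mul0r; lra.
have E1 : w k = w (i + 1).
  by move: e1 e2; case: (w i) (w k) (w (i + 1)) => [a b] [c d] [e f] /=; move=> *; congr pair; lia.
have E2 : w (k + 1) = w i.
  by move: e1 e2 e3 e4; case: (w i) (w k) (w (i + 1)) (w (k + 1)) => [a b] [c d] [e f] [g h] /=;
    clear; move=> *; congr pair; lia.
have d2 : (m%:Z %| (k + 1 - i) + (k - (i + 1)) - 2 * (k - (i + 1)))%Z.
  by apply: rpredB; [apply: rpredD; exact: w_inj|apply: dvdz_mull; exact: w_inj].
exfalso; apply: not_dvd d2.
have -> : (k + 1 - i) + (k - (i + 1)) - 2 * (k - (i + 1)) = 2 by ring.
by move: m3; clear; lia.
Qed.

(** The window of length [1] lies over the edges [j] and [j + 1], and the direction is the sum of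
    their vectors: its product with each is [2] on a straight stretch and [1] at a right angle. It
    is [0] only for an immediate return, which injectivity forbids. *)
Lemma interp_walk_monotone x : exists u v : R, [/\ `|u| <= 2, `|v| <= 2 &
  forall a b, x - 1 / 2 <= a -> a <= b -> b <= x + 1 / 2 ->
   1 * (b - a) <= u * (interp X b - interp X a) + v * (interp Y b - interp Y a)].
Proof.
pose j := Num.floor (x - 1 / 2).
pose a := (w (j + 1)).1 - (w j).1; pose b := (w (j + 1)).2 - (w j).2.
pose a' := (w (j + 1 + 1)).1 - (w (j + 1)).1; pose b' := (w (j + 1 + 1)).2 - (w (j + 1)).2.
have ab : `|a| + `|b| = 1 := walk_unit_step j.
have ab' : `|a'| + `|b'| = 1 := walk_unit_step (j + 1).
have nb : ~ (a' = - a /\ b' = - b).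
  move=> [e1 e2]; have E : w (j + 1 + 1) = w j.
    move: e1 e2; rewrite /a /b /a' /b'; case: (w (j + 1 + 1)) (w (j + 1)) (w j) => [p q] [r s] [t u] /= *.
    by congr pair; lia.
  have := w_inj E; have -> : j + 1 + 1 - j = 2 by ring.
  by apply: not_dvd; move: m3; clear; lia.
have turn (p q p' q' : int) : `|p| + `|q| = 1 -> `|p'| + `|q'| = 1 -> ~ (p' = - p /\ q' = - q) ->
    1 <= (p + p') * p + (q + q') * q /\ 1 <= (p + p') * p' + (q + q') * q'.
  move=> /unit_step[e0 [he pq]] /unit_step[f0 [hf pq']] h.
  by case: pq pq' he hf h => -[-> ->] [] [-> ->] [->|->] [->|->] h; (try by case: h); split.
exists (a + a')%:~R, (b + b')%:~R; split.
- rewrite -intr_norm -[2]/(2%:~R : R) ler_int; lia.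
- rewrite -intr_norm -[2]/(2%:~R : R) ler_int; lia.
move=> c d hc cd hd.
have [j0 j1] := andP (floor_itv (x - 1 / 2)); rewrite -/j intrD in j0 j1.
have := @interp_ge R (fun i => (a + a')%:~R * X i + (b + b')%:~R * Y i) 1 j (j + 1 + 1) c d.
rewrite !interp_lin => h.
have {h} h := h _ (le_trans j0 hc) cd.
suff : 1 * (d - c) <= (a + a')%:~R * interp X d + (b + b')%:~R * interp Y d -
   ((a + a')%:~R * interp X c + (b + b')%:~R * interp Y c) by lra.
apply: h; last by rewrite !intrD; lra.
move=> l hl; have : (l == j) || (l == j + 1) by lia.
rewrite /X /Y; move=> /orP[] /eqP ->.
  have -> : (a + a')%:~R * (w (j + 1)).1%:~R + (b + b')%:~R * (w (j + 1)).2%:~R -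
     ((a + a')%:~R * (w j).1%:~R + (b + b')%:~R * (w j).2%:~R) =
     ((a + a') * a + (b + b') * b)%:~R :> R.
    by rewrite /a /b !(intrD, intrM, intrB); ring.
  rewrite -[1]/(1%:~R : R) ler_int.
    exact: (turn _ _ _ _ ab ab' nb).1.
have -> : (a + a')%:~R * (w (j + 1 + 1)).1%:~R + (b + b')%:~R * (w (j + 1 + 1)).2%:~R -
     ((a + a')%:~R * (w (j + 1)).1%:~R + (b + b')%:~R * (w (j + 1)).2%:~R) =
     ((a + a') * a' + (b + b') * b')%:~R :> R.
  by rewrite {2}/a' {2}/b' !(intrD, intrM, intrB); ring.
rewrite -[1]/(1%:~R : R) ler_int.
exact: (turn _ _ _ _ ab ab' nb).2.
Qed.

End LatticeWalk.

(** * Lattice approximation of a curve *)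

Lemma unif_cont (R : realType) (g : R -> 'rV[R]_2) (e : R) :
  periodic g 1 -> continuous g -> 0 < e ->
  exists2 d : R, 0 < d & forall s t, `|s - t| <= d -> `|g s - g t| <= e.
Proof.
move=> pg cg e0.
have : near_covering (`[0, 1]%classic : set R) by apply/compact_near_coveringP; exact: segment_compact.
move=> /(_ R 0^'+ (fun d x => forall y, `|x - y| <= d -> `|g x - g y| <= e)) H.
have {}H : \forall d \near 0^'+, `[0, 1]%classic `<=`
    (fun x : R => forall y, `|x - y| <= d -> `|g x - g y| <= e).
  apply: H => x _.
  have e2 : 0 < e / 2 by rewrite divr_gt0.
  have /cvgrPdist_le/(_ _ e2)/nbhs_ballP[r /= r0 hr] := cg x.
  near=> x' d => y x'y.
  have hx' : `|x - x'| < r / 2.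
    by near: x'; apply: nbhsx_ballx; rewrite divr_gt0.
  have hd : d < r / 2.
    by near: d; apply: nbhs_right_lt; rewrite divr_gt0.
  have h1 : `|g x - g x'| <= e / 2 by apply: hr; rewrite /ball/=; lra.
  have h2 : `|g x - g y| <= e / 2.
    apply: hr; rewrite /ball/=.
    have -> : x - y = (x - x') + (x' - y) by ring.
    apply: (le_lt_trans (ler_normD _ _)). by move: x'y hx' hd; rewrite /=; lra.
  have -> : g x' - g y = (g x - g y) - (g x - g x') by rewrite opprB [RHS]addrC addrA subrK.
  by apply: (le_trans (ler_normB _ _)); lra.
have : \forall d \near 0^'+, 0 < d /\ `[0, 1]%classic `<=`
    (fun x : R => forall y, `|x - y| <= d -> `|g x - g y| <= e).
  by near=> d; split; [near: d; exact: nbhs_right_gt|near: d].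
move=> /filter_ex[d [d0 hd]]; exists d => // s t st.
have [k /andP[k0 k1]] := frac_itv s.
have := hd (s - k%:~R) _ (t - k%:~R).
rewrite -!mulrNz !(periodicz _ _ pg) !mulrNz => h; apply: h.
  by rewrite /= in_itv/= k0 ltW.
by rewrite opprB addrA subrK.
Unshelve. all: by end_near. Qed.

(** The tolerance has two sources: rounding down costs at most [e], and so does the motion of the
    curve over one sampling step. *)
Definition lattice_near (R : realType) (g : R -> 'rV[R]_2) (e : R) (v : int * int) (t : R) : Prop :=
  `|e * v.1%:~R - g t 0 0| <= 2 * e /\ `|e * v.2%:~R - g t 0 1| <= 2 * e.

Lemma lattice_near_periodic (R : realType) (g : R -> 'rV[R]_2) (e : R) v t (k : int) :
  periodic g 1 -> lattice_near g e v t -> lattice_near g e v (t + k%:~R).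
Proof. by move=> pg; rewrite /lattice_near !periodicz. Qed.

Lemma divz2_cases (j : int) :
  (((j + 1) %/ 2)%Z = (j %/ 2)%Z /\ 2 * (j %/ 2)%Z = j) \/
  (((j + 1) %/ 2)%Z = (j %/ 2)%Z + 1 /\ 2 * (j %/ 2)%Z = j - 1).
Proof. by lia. Qed.

Lemma floor_dist (R : realType) (a b : R) : `|a - b| <= 1 ->
  `|Num.floor a - Num.floor b| <= 1.
Proof.
rewrite ler_norml => /andP[h1 h2].
have ha := floor_itv a; have hb := floor_itv b.
have h : -2 < ((Num.floor a - Num.floor b)%:~R : R) < 2.
  by move: ha hb; rewrite intrB !intrD; lra.
move: h; rewrite -[2]/(2%:~R : R) -mulrNz !ltr_int; clear; lia.
Qed.

(** Rounded samples may change both coordinates at once. Running at twice the sampling rate and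
    updating the coordinates in turn rules out diagonal steps. *)
Lemma lattice_walk_exists (R : realType) (g : R -> 'rV[R]_2) (e : R) :
  periodic g 1 -> continuous g -> 0 < e ->
  exists m w s, closed_walk (lattice_near g e) int_adj m w s.
Proof.
move=> pg cg e0; have [d d0 hd] := unif_cont pg cg e0.
(* One successor gives [1 / M <= d]; the other gives [2 <= M], so that the time steps [1 / (2 * M)]
   stay below [1 / 2]. *)
pose M := (Num.truncn (d^-1)).+2.
have M0 : 0 < (M%:R : R) by rewrite ltr0n.
have Md : (M%:R : R)^-1 <= d.
  rewrite -[d]invrK lef_pV2 ?posrE ?invr_gt0//.
  by apply: (le_trans (ltW (truncnS_gt _))); rewrite ler_nat.
have M2 : 2 <= (M%:R : R) by rewrite ler_nat.
pose X i (k : int) := Num.floor (g (k%:~R / M%:R) 0 i / e).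
have Xper i k : X i (k + M%:Z) = X i k.
  have E : (k + M%:Z)%:~R / M%:R = k%:~R / M%:R + 1 :> R.
    by rewrite intrD mulrDl divff ?gt_eqF.
  by rewrite /X E pg.
have Xnear i (k : int) (t : R) : `|k%:~R / M%:R - t| <= M%:R^-1 ->
    `|e * (X i k)%:~R - g t 0 i| <= 2 * e.
  move=> kt; have := hd _ _ (le_trans kt Md) => h.
  have := coord_le_norm (g (k%:~R / M%:R) - g t) i; rewrite !mxE => h'.
  have := floor_itv (g (k%:~R / M%:R) 0 i / e); rewrite -/(X i k) intrD.
  rewrite ler_pdivlMr// ltr_pdivrMr//.
  have := le_trans h' h; rewrite !ler_norml; lra.
have Xstep i k : `|X i (k + 1) - X i k| <= 1.
  apply: floor_dist; rewrite -mulrBl normrM normfV (gtr0_norm e0) ler_pdivrMr// mul1r.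
  have := coord_le_norm (g ((k + 1)%:~R / M%:R) - g (k%:~R / M%:R)) i; rewrite !mxE => h'.
  apply: (le_trans h'); apply: hd; rewrite intrD -mulrBl addrAC subrr add0r mul1r.
  by rewrite ger0_norm// invr_ge0 ltW.
exists (2 * M)%N, (fun j => (X 0 ((j + 1) %/ 2)%Z, X 1 (j %/ 2)%Z)),
  (fun j => j%:~R / (2 * M%:R)).
have dE (j : int) : j%:~R / (2 * M%:R) = j%:~R / 2 / M%:R :> R by rewrite invfM mulrA.
have near_aux (k j : int) : -2 <= 2 * k - j <= 2 ->
    `|k%:~R / M%:R - j%:~R / (2 * M%:R)| <= (M%:R : R)^-1.
  move=> kj; rewrite dE -mulrBl normrM (gtr0_norm (_ : 0 < M%:R^-1)) ?invr_gt0//.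
  rewrite ler_piMl ?invr_ge0 ?(ltW M0)//.
  have : -2 <= ((2 * k - j)%:~R : R) <= 2.
    have -> : 2 = 2%:~R :> R by [].
        by rewrite -mulrNz !ler_int.
  by rewrite intrB intrM ler_norml; lra.
split.
- by rewrite muln_gt0.
- move=> i; have -> : ((i + (2 * M)%N + 1) %/ 2)%Z = ((i + 1) %/ 2)%Z + M%:Z by clear; lia.
  have -> : ((i + (2 * M)%N) %/ 2)%Z = (i %/ 2)%Z + M%:Z by clear; lia.
  by rewrite !Xper.
- move=> i; rewrite intrD mulrDl; congr (_ + _).
  by rewrite -pmulrn natrM divff// mulf_neq0// gt_eqF.
- move=> i.
  have -> : (i + 1)%:~R / (2 * M%:R) - i%:~R / (2 * M%:R) = (2 * M%:R)^-1 :> R.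
    by rewrite -mulrBl intrD addrAC subrr add0r mul1r.
  rewrite invr_gt0 mulr_gt0//=.
  rewrite mul1r ltf_pV2 ?posrE ?mulr_gt0//; lra.
- move=> i; split.
  + by split; apply/Xnear/near_aux; case: (divz2_cases i) => -[e1 e2]; rewrite ?e1; move: e2; clear; lia.
  + have E2 : ((i + 1 + 1) %/ 2)%Z = (i %/ 2)%Z + 1 by clear; lia.
    by split; apply/Xnear/near_aux; case: (divz2_cases i) => -[e1 e2];
      rewrite ?E2 ?e1; move: e2; clear; lia.
  + rewrite /int_adj /=; have -> : ((i + 1 + 1) %/ 2)%Z = (i %/ 2)%Z + 1 by clear; lia.
    case: (divz2_cases i) => -[-> _].
      by rewrite (subrr (X 1 _)) normr0 addr0 Xstep.
    by rewrite subrr normr0 add0r Xstep.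
Qed.

Lemma interp_le (R : realType) (f : int -> R) (a : R) (x y : R) :
  (forall j, f (j + 1) - f j <= a) -> x <= y -> interp f y - interp f x <= a * (y - x).
Proof.
move=> fa xy; have [x0 _] := andP (floor_itv x); have [_ y1] := andP (floor_itv y).
have := @interp_ge R (fun j => -1 * f j + 0 * f j) (- a) _ _ _ _ _ x0 xy (ltW y1).
rewrite !interp_lin => h.
have : - a * (y - x) <= -1 * interp f y + 0 * interp f y - (-1 * interp f x + 0 * interp f x).
  by apply: h => j _; have := fa j; lra.
lra.
Qed.

Lemma interp_ge_all (R : realType) (f : int -> R) (a : R) (x y : R) :
  (forall j, a <= f (j + 1) - f j) -> x <= y -> a * (y - x) <= interp f y - interp f x.
Proof.
move=> fa xy; have [x0 _] := andP (floor_itv x); have [_ y1] := andP (floor_itv y).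
by apply: (@interp_ge R f a _ _ _ _ _ x0 xy (ltW y1)) => j _.
Qed.

Lemma periodic_pos_min (R : realType) (m : nat) (f : int -> R) : (0 < m)%N ->
  (forall i, f (i + m%:Z) = f i) -> (forall i, 0 < f i) ->
  exists2 c, 0 < c & forall i, c <= f i.
Proof.
move=> m0 pf f0.
have [c c0 hc] : exists2 c, 0 < c & forall i : nat, (i < m)%N -> c <= f i%:Z.
  elim: m {m0 pf} => [|m [c c0 hc]]; first by exists 1.
  exists (Num.min c (f m%:Z)); first by rewrite lt_min c0 f0.
  move=> i; rewrite ltnS leq_eqVlt => /predU1P[->|im]; first by rewrite ge_min lexx orbT.
  by rewrite ge_min hc.
exists c => // i.
have pn (n : nat) k : f (k + n%:Z * m%:Z) = f k.
  elim: n k => [|n IH] k; first by rewrite mul0r addr0.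
  by rewrite intS mulrDl mul1r addrA IH pf.
have pz k : f (k + (i %/ m)%Z * m%:Z) = f k.
  case: (i %/ m)%Z => q; first exact: pn.
  by rewrite NegzE -(pn q.+1) mulNr subrK.
rewrite (divz_eq i m) addrC pz.
have mz : m%:Z != 0 by move: m0; clear; lia.
have r0 := modz_ge0 i mz; have r1 : ((i %% m)%Z < m%:Z) by rewrite ltz_pmod// ltz_nat.
by move: r0 r1; case: (i %% m)%Z => // r _; rewrite ltz_nat; exact: hc.
Qed.

(** [phi t] is the position along the walk at time [t], the inverse of [interp s]. By periodicity
    the steps of [s] have a positive minimum [c], so the slopes lie between [c] and [d]. *)
Lemma walk_time_inverse (R : realType) (m : nat) (s : int -> R) (d : R) : (0 < m)%N ->
  (forall i, s (i + m%:Z) = s i + 1) -> (forall i, 0 < s (i + 1) - s i <= d) ->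
  exists phi : R -> R, exists2 c, 0 < c &
  [/\ forall t, interp s (phi t) = t, forall t, phi (t + 1) = phi t + m%:R &
   forall a b, a <= b -> [/\ phi a <= phi b, c * (phi b - phi a) <= b - a &
     b - a <= d * (phi b - phi a)]].
Proof.
move=> m0 ps gap.
have [c c0 hc] : exists2 c, 0 < c & forall i, c <= s (i + 1) - s i.
  apply: (@periodic_pos_min R m (fun i => s (i + 1) - s i)) => // i.
    by rewrite addrAC !ps; ring.
  by have /andP[] := gap i.
have hd i : s (i + 1) - s i <= d by have /andP[] := gap i.
have psi x y : x <= y ->
    c * (y - x) <= interp s y - interp s x /\ interp s y - interp s x <= d * (y - x).
  by move=> xy; split; [exact: interp_ge_all|exact: interp_le].
have d0 : 0 <= d by have := gap 0; lra.
have cpsi : continuous (interp s).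
  apply: (@lipschitz_fun_continuous R d); apply: interp_lipschitz => j.
  by have := gap j => /andP[h1 h2]; rewrite gtr0_norm.
have psim x (k : int) : interp s (x + (k * m%:Z)%:~R) = interp s x + k%:~R.
  apply: interp_shift => j.
  have pn (n : nat) i : s (i + n%:Z * m%:Z) = s i + n%:R.
    elim: n i => [|n IH] i; first by rewrite mul0r !addr0.
    by rewrite intS mulrDl mul1r addrA IH ps -natr1; ring.
  case: k => q; first by rewrite pn.
  have := pn q.+1 (j - q.+1%:Z * m%:Z); rewrite subrK => ->.
  by rewrite NegzE mulrNz -pmulrn mulNr addrK.
have surj t : exists x, interp s x = t.
  pose k := Num.floor (t - s 0).
  have [k0 k1] := andP (floor_itv (t - s 0)); rewrite -/k intrD in k0 k1.
  have e0 : interp s 0 = s 0 by rewrite -[0]/(0%:~R : R) interp_int.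
  have h1 := psim 0 k; have h2 := psim 0 (k + 1); rewrite !add0r e0 in h1 h2.
  have le : (k * m%:Z)%:~R <= ((k + 1) * m%:Z)%:~R :> R.
    by rewrite ler_int mulrDl mul1r lerDl.
  have cw : {within `[(k * m%:Z)%:~R, ((k + 1) * m%:Z)%:~R], continuous (interp s)}.
    exact: within_continuousT.
  have [] := @IVT R (interp s) _ _ t le cw; last by move=> x _ <-; exists x.
  by rewrite h1 h2 intrD ge_min le_max; apply/andP; split; apply/orP; [left|right]; lra.
have [phi hphi] := choice surj.
have inj x y : interp s x = interp s y -> x = y.
  move=> E; have [xy|yx|//] := ltgtP x y.
    by have [h _] := psi _ _ (ltW xy); move: h; rewrite E subrr; nra.
  by have [h _] := psi _ _ (ltW yx); move: h; rewrite E subrr; nra.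
exists phi, c => //; split => //.
  move=> t; apply: inj; have := psim (phi t) 1; rewrite mul1r -pmulrn => ->.
  by rewrite !hphi.
move=> a b ab.
have le : phi a <= phi b.
  rewrite leNgt; apply/negP => h; have [h1 _] := psi _ _ (ltW h); rewrite !hphi in h1.
  have : 0 < c * (phi a - phi b) by rewrite mulr_gt0// subr_gt0.
  lra.
by have [] := psi _ _ le; rewrite !hphi.
Qed.

Lemma ord2 (i : 'I_2) : i = 0 \/ i = 1.
Proof. by case: i => [[|[|]]] // h; [left|right]; apply/val_inj. Qed.

Lemma walk_gap_lt (R : realType) (V : Type) (near : V -> R -> Prop) adj m w s (d : R) :
  (forall v a b, near v a -> near v b -> 0 <= b - a <= 1 -> b - a < d \/ 1 - d < b - a) ->
  d <= 1 / 6 -> closed_walk near adj m w s -> forall i, s (i + 1) - s i < d.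
Proof.
move=> sep d6 [_ _ _ gap edge] i.
have [_ h1 _] := edge i; have [h2 _ _] := edge (i + 1); have h := gap i.
have := sep _ _ _ h1 h2; lra.
Qed.

Lemma walk_time_mono (R : realType) (s : int -> R) :
  (forall i, s i <= s (i + 1)) -> forall i k, i <= k -> s i <= s k.
Proof. by move=> h i k ik; apply: (@nondecreasing_steps R s i k). Qed.

(** [tau t] is the time stamp of the edge carrying [P t]. Both ends of that edge are within [2 * e]
    of [g (tau t)], hence so is [P t] by convexity, which gives the error [4 * e] on increments. The
    other bound, [e] per edge travelled, serves increments within an edge, where errors [4 * e]
    would pile up over fine partitions. *)
Lemma lattice_approx (R : realType) (g : R -> 'rV[R]_2) (eta : R) :
  jordan_parametrization g -> 0 < eta ->
  exists e m w s phi P, let tau t := s (Num.floor (phi t)) in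
  [/\ 0 < e <= eta,
      closed_walk (lattice_near g e) int_adj m w s /\
        (forall i j, w i = w j -> (m%:Z %| i - j)%Z),
      forall t, [/\ phi (t + 1) = phi t + m%:R, `|P t - g t| <= 3 * eta & t - 1 <= tau t <= t],
      forall a b, a <= b -> [/\ phi a <= phi b, tau a <= tau b,
        `|P b - P a| <= `|g (tau b) - g (tau a)| + 4 * e & `|P b - P a| <= e * (phi b - phi a)] &
      [/\ periodic P 1, {in `[0, 1[ &, injective P} &
        exists L d c, [/\ forall i, lipschitz_fun L (fun t => P t 0 i), 0 < d, 0 < c &
          locally_monotone d c P]]].
Proof.
move=> jg eta0; have [pg cg ig] := jg.
have [d1 d10 hd1] := unif_cont pg cg eta0.
pose d : R := Num.min d1 (1 / 6).
have d0 : 0 < d by rewrite lt_min d10; lra.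
have d6 : d <= 1 / 6 by rewrite ge_min lexx orbT.
have dd1 : d <= d1 by rewrite ge_min lexx.
have d12 : 0 < d <= 1 / 2 by apply/andP; split => //; lra.
have [r r0 hr] := unif_inj jg d12.
(* At two times near the same vertex the curve points are at most [4 * e] apart; keeping this below
   the injectivity gap [r] makes loops short. *)
pose e := Num.min eta (r / 4).
have e0 : 0 < e by rewrite lt_min eta0; lra.
have ee : e <= eta by rewrite ge_min lexx.
have e4 : e <= r / 4 by rewrite ge_min lexx orbT.
have er : 4 * e <= r by lra.
have sep v a b : lattice_near g e v a -> lattice_near g e v b -> 0 <= b - a <= 1 ->
    b - a < d \/ 1 - d < b - a.
  move=> [a1 a2] [b1 b2] ab.
  have [h1|h1] := ltP (b - a) d; first by left.
  have [h2|h2] := ltP (1 - d) (b - a); first by right.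
  have := hr a b; rewrite h1 h2 => /(_ isT); rewrite ltNge => /negP[].
  apply: norm_rV_le; first exact: ltW.
  move=> i; rewrite !mxE; case: (ord2 i) => ->.
    by move: a1 b1; rewrite !ler_norml; lra.
  by move: a2 b2; rewrite !ler_norml; lra.
have [m0 [w0 [s0 cw0]]] := lattice_walk_exists pg cg e0.
have nper v t (k : int) := @lattice_near_periodic R g e v t k pg.
have [m [w [s [cw inj]]]] := loop_erasure nper d6 sep cw0.
have gapd := walk_gap_lt sep d6 cw.
have [mpos pw ps gap edge] := cw.
have smono : forall i k, i <= k -> s i <= s k.
  by apply: walk_time_mono => i; have := gap i; lra.
(* A period has length [1] and each step takes less than [1 / 6], so two steps cannot suffice. *)
have m3 : (2 < m)%N.
  have hs (n : nat) : s n%:Z - s 0 <= n%:R * d.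
    elim: n => [|n IH]; first by rewrite subrr mul0r.
    by have := gapd n%:Z; rewrite intS (addrC 1) -natr1; lra.
  have := hs m; have := ps 0; rewrite add0r => -> h.
  rewrite -(ltr_nat R) ltNge; apply/negP => m2.
  have : m%:R * d <= 2 * (1 / 6) by apply: ler_pM => //; exact: ltW.
  lra.
have gap' i : 0 < s (i + 1) - s i <= d.
  by have := gap i => /andP[-> _]; rewrite ltW.
have [phi [c0 c00 [hphi phi1 phim]]] := walk_time_inverse mpos ps gap'.
pose X i : R := (w i).1%:~R; pose Y i : R := (w i).2%:~R.
pose P : R -> 'rV[R]_2 := fun t =>
  \row_(i < 2) (if i == 0 then e * interp X (phi t) else e * interp Y (phi t)).
have P0 t : P t 0 0 = e * interp X (phi t) by rewrite mxE.
have P1 t : P t 0 1 = e * interp Y (phi t) by rewrite mxE.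
have w_adj i : int_adj (w i) (w (i + 1)) by have [] := edge i.
have per_interp (f : int -> R) x : (forall j, f (j + m%:Z) = f j) ->
    interp f (x + m%:R) = interp f x.
  move=> pf; have := @interp_shift R f m 0 x; rewrite -pmulrn addr0; apply => j.
  by rewrite pf addr0.
have Xlip : lipschitz_fun 1 (interp X).
  apply: interp_lipschitz => j; rewrite /X -intrB -intr_norm -[1]/(1%:~R : R) ler_int.
  by have := w_adj j; rewrite /int_adj; move: (w (j + 1)) (w j) => u v; clear; lia.
have Ylip : lipschitz_fun 1 (interp Y).
  apply: interp_lipschitz => j; rewrite /Y -intrB -intr_norm -[1]/(1%:~R : R) ler_int.
  by have := w_adj j; rewrite /int_adj; move: (w (j + 1)) (w j) => u v; clear; lia.
pose tau t := s (Num.floor (phi t)).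
have tauP t : tau t <= t <= tau t + d.
  have := floor_itv (phi t) => /andP[h1]; rewrite intrD => h2.
  have := interp_ge_all (a := 0) (fun j => ltW (proj1 (andP (gap' j)))) h1.
  have := interp_ge_all (a := 0) (fun j => ltW (proj1 (andP (gap' j)))) (ltW h2).
  have -> : interp s ((Num.floor (phi t))%:~R + 1) = s (Num.floor (phi t) + 1).
    by rewrite -[1]/(1%:~R : R) -intrD interp_int.
  rewrite interp_int hphi !mul0r -/(tau t).
  have := gapd (Num.floor (phi t)); rewrite -/(tau t); lra.
have Pnear t : `|P t - g (tau t)| <= 2 * e.
  have [h1 h2] := andP (floor_itv (phi t)); rewrite intrD in h2.
  have [[a1 a2] [b1 b2] _] := edge (Num.floor (phi t)); rewrite -/(tau t) in a1 a2 b1 b2.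
  apply: norm_rV_le; first by rewrite mulr_ge0// ltW.
  have t01 : 0 <= phi t - (Num.floor (phi t))%:~R <= 1 by apply/andP; split; lra.
  have conv (u v z l q : R) : 0 <= l <= 1 -> `|u - z| <= q -> `|v - z| <= q ->
      `|u + l * (v - u) - z| <= q.
    move=> /andP[l0 l1] /[!ler_norml] /andP[u1 u2] /andP[v1 v2].
    by apply/andP; split; nra.
  move=> i; rewrite 2!mxE; case: (ord2 i) => -> /=; rewrite [X in _ + X]mxE /interp mulrDr mulrCA mulrBr.
    exact: conv.
  exact: conv.
have tau_mono a b : a <= b -> tau a <= tau b.
  by move=> ab; apply/smono/le_floor; have [] := phim _ _ ab.
exists e, m, w, s, phi, P; split.
- by rewrite e0.
- by split.
- move=> t; have ht := tauP t; split => //; last by rewrite -/(tau t); apply/andP; split; lra.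
  have -> : P t - g t = (P t - g (tau t)) + (g (tau t) - g t) by rewrite addrA subrK.
  apply: (le_trans (ler_normD _ _)).
  have : `|g (tau t) - g t| <= eta.
    by apply: hd1; rewrite ler_norml; apply/andP; split; lra.
  have := Pnear t; lra.
- move=> a b ab; have [h1 h2 h3] := phim _ _ ab; split => //; first exact: tau_mono.
    rewrite -/(tau a) -/(tau b).
    have -> : P b - P a = (g (tau b) - g (tau a)) + ((P b - g (tau b)) - (P a - g (tau a))).
      by apply/rowP => i; rewrite !mxE; ring.
    apply: (le_trans (ler_normD _ _)); rewrite lerD2l.
    apply: (le_trans (ler_normB _ _)); have := Pnear a; have := Pnear b; lra.
  apply: norm_rV_le; first by apply: mulr_ge0; [exact: ltW|rewrite subr_ge0].
  move=> i; rewrite !mxE.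
  case: (ord2 i) => -> /=; rewrite -mulrBr normrM gtr0_norm// (ler_pM2l e0).
        by apply: (le_trans (Xlip _ _)); rewrite mul1r ger0_norm ?subr_ge0.
  by apply: (le_trans (Ylip _ _)); rewrite mul1r ger0_norm ?subr_ge0.
- split.
  + move=> t; apply/rowP => i; rewrite !mxE phi1.
    by case: ifP => _; rewrite per_interp// => j; rewrite /X /Y pw.
  + have key a b : 0 <= a -> a <= b -> b < 1 -> P a = P b -> a = b.
      move=> a0 ab b1 E.
      have EX : interp X (phi a) = interp X (phi b).
        by apply: (mulfI (lt0r_neq0 e0)); rewrite -!P0 E.
      have EY : interp Y (phi a) = interp Y (phi b).
        by apply: (mulfI (lt0r_neq0 e0)); rewrite -!P1 E.
      have h : `|phi a - phi b| < m%:R.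
        have [h1 _ _] := phim _ _ ab; rewrite distrC ger0_norm ?subr_ge0//.
        have ba1 : b <= a + 1 by lra.
        have [_ _] := phim _ _ ba1; rewrite phi1 => h2.
        have : 0 < a + 1 - b by lra.
        move=> h3; have : 0 < d * (phi a + m%:R - phi b) by apply: lt_le_trans h2.
        by rewrite pmulr_rgt0//; lra.
      have := interp_walk_inj m3 w_adj inj EX EY h => Ephi.
      by rewrite -(hphi a) -(hphi b) Ephi.
    move=> a b; rewrite !in_itv/= => /andP[a0 a1] /andP[b0 b1] E.
    by have [ab|ba] := leP a b; [exact: key|apply/esym/key => //; exact: ltW].
  (* Position moves at a rate between [1 / d] and [1 / c0]. A time window of radius [c0 / 2] thus
     stays within [1 / 2] in position, the scale of [interp_walk_monotone], and the rate [1] there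
     becomes [e / d] in time. *)
  + exists (e / c0), (c0 / 2), (e / d); split; rewrite ?divr_gt0//.
      have lip (F : R -> R) : lipschitz_fun 1 F -> lipschitz_fun (e / c0) (fun t => e * F (phi t)).
        move=> lF; have key a b : a <= b -> `|e * F (phi a) - e * F (phi b)| <= e / c0 * `|a - b|.
          move=> ab; have [h1 h2 _] := phim _ _ ab.
          rewrite -mulrBr normrM gtr0_norm// -mulrA (ler_pM2l e0).
          apply: (le_trans (lF _ _)); rewrite mul1r distrC ger0_norm ?subr_ge0// distrC.
          by rewrite ger0_norm ?subr_ge0// mulrC ler_pdivlMr// mulrC.
        move=> a b; have [ab|ba] := leP a b; first exact: key.
        by rewrite distrC (distrC a); apply/key/ltW.
      move=> i; case: (ord2 i) => ->; under [X in lipschitz_fun _ X]funext do rewrite ?P0 ?P1.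
        exact: lip.
      exact: lip.
    move=> t; have [u [v [u2 v2 mono]]] := @interp_walk_monotone R m w m3 w_adj inj (phi t).
    exists u, v; split => // a b ta ab tb; rewrite !P0 !P1.
    have hX z : t - c0 / 2 <= z <= t + c0 / 2 -> phi t - 1 / 2 <= phi z <= phi t + 1 / 2.
      move=> /andP[z1 z2]; have [zt|tz] := leP z t.
        have [h1 h2 _] := phim _ _ zt; apply/andP; split; nra.
      have [h1 h2 _] := phim _ _ (ltW tz); apply/andP; split; nra.
    have [h1 _ h3] := phim _ _ ab.
    have /andP[ha _] : phi t - 1 / 2 <= phi a <= phi t + 1 / 2.
      by apply: hX; apply/andP; split; lra.
    have /andP[_ hb] : phi t - 1 / 2 <= phi b <= phi t + 1 / 2.
      by apply: hX; apply/andP; split; lra.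
    have := mono _ _ ha h1 hb; rewrite mul1r => h.
    have -> : u * (e * interp X (phi b) - e * interp X (phi a)) +
       v * (e * interp Y (phi b) - e * interp Y (phi a)) =
       e * (u * (interp X (phi b) - interp X (phi a)) + v * (interp Y (phi b) - interp Y (phi a))) by ring.
    rewrite -mulrA (ler_pM2l e0); apply: le_trans h.
    by rewrite mulrC ler_pdivrMr// mulrC.
Qed.

(** * Variation sums *)

Fixpoint vsum (R : realType) (D : R -> R -> R) (x : R) (l : seq R) : R :=
  if l is y :: l' then D x y + vsum D y l' else 0.

Lemma rvariation_sumE (R : realType) (r : R) (f : R -> 'rV[R]_2) (s : seq R) :
  rvariation_sum r f s = vsum (fun a b => enorm (f b - f a) `^ r) 0 s.
Proof.
have key x : \sum_(0 <= j < size s)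
    enorm (f (nth 1 (x :: s) j.+1) - f (nth 1 (x :: s) j)) `^ r =
    vsum (fun a b => enorm (f b - f a) `^ r) x s.
  elim: s x => [|y s IH] x /=; first by rewrite big_geq.
  by rewrite big_nat_recl//= -IH.
exact: key.
Qed.

Lemma vsum_le (R : realType) (D D' : R -> R -> R) (x : R) (l : seq R) :
  (forall a b, a <= b -> D a b <= D' a b) -> path <=%R x l -> vsum D x l <= vsum D' x l.
Proof.
move=> h; elim: l x => //= y l IH x /andP[xy pl].
by apply: lerD; [exact: h|exact: IH].
Qed.

Lemma vsum_lin (R : realType) (D D' : R -> R -> R) (u v x : R) (l : seq R) :
  vsum (fun a b => u * D a b + v * D' a b) x l = u * vsum D x l + v * vsum D' x l.
Proof.
elim: l x => [|y l IH] x /=; first by rewrite !mulr0 addr0.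
by rewrite IH; ring.
Qed.

Lemma vsum_map (R : realType) (D : R -> R -> R) (f : R -> R) (x : R) (l : seq R) :
  vsum D (f x) (map f l) = vsum (fun a b => D (f a) (f b)) x l.
Proof. by elim: l x => //= y l IH x; rewrite IH. Qed.

Lemma vsum_map_le (R : realType) (D : R -> R -> R) (f : R -> R) (B x : R) (l : seq R) :
  vsum D (f x) (map f l) <= B -> vsum (fun a b => D (f a) (f b)) x l <= B.
Proof. by rewrite vsum_map. Qed.

Lemma vsum_telescope (R : realType) (f : R -> R) (x : R) (l : seq R) :
  vsum (fun a b => f b - f a) x l = f (last x l) - f x.
Proof.
elim: l x => [|y l IH] x /=; first by rewrite subrr.
by rewrite IH; ring.
Qed.

Lemma vsum_ge0 (R : realType) (D : R -> R -> R) (x : R) (l : seq R) :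
  (forall a b, 0 <= D a b) -> 0 <= vsum D x l.
Proof. by move=> D0; elim: l x => //= y l IH x; rewrite addr_ge0. Qed.

(** A monotone map such as [tau] may create repetitions, whereas [itv_partition] is strict; a
    repetition contributes [D a a], that is, nothing. *)
Lemma vsum_strict (R : realType) (D : R -> R -> R) (x : R) (l : seq R) :
  (forall a, D a a = 0) -> path <=%R x l ->
  exists l', [/\ path <%R x l', last x l' = last x l & vsum D x l' = vsum D x l].
Proof.
move=> D0; elim: l x => [|y l IH] x /=; first by exists [::].
move=> /andP[xy /IH[l' [pl' ll' vl']]].
have [E|xy'] := eqVneq x y; first by exists l'; rewrite E ll' vl' D0 add0r -E; rewrite -E in pl'.
by exists (y :: l') => /=; rewrite lt_neqAle xy' xy pl' ll' vl'.
Qed.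

Lemma vsum_cat1 (R : realType) (D : R -> R -> R) (x y : R) (l : seq R) :
  vsum D x (rcons l y) = vsum D x l + D (last x l) y.
Proof.
elim: l x => [|z l IH] x /=; first by rewrite addr0 add0r.
by rewrite IH addrA.
Qed.

(** With [D] nonnegative, adding the missing endpoints [0] and [1] only enlarges the sum. *)
Lemma vsum_partition_le (R : realType) (D : R -> R -> R) (B x : R) (l : seq R) :
  (forall a b, 0 <= D a b) -> (forall a, D a a = 0) ->
  (forall s, itv_partition 0 1 s -> vsum D 0 s <= B) ->
  path <=%R x l -> 0 <= x -> last x l <= 1 -> vsum D x l <= B.
Proof.
move=> D0 D00 hB /(vsum_strict D00)[l' [pl' <- <-]] x0 l1.
have [l2 [pl2 ll2 vl2]] : exists l2, [/\ path <%R 0 l2, last 0 l2 = last x l' &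
    vsum D x l' <= vsum D 0 l2].
  have [E|x0'] := eqVneq x 0; first by exists l'; rewrite E in pl' *.
  by exists (x :: l') => /=; rewrite lt_neqAle eq_sym x0' x0 pl' lerDr.
apply: (le_trans vl2); rewrite -ll2 in l1.
have [E|x1] := eqVneq (last 0 l2) 1; first by apply: hB; split => //; rewrite E.
apply: (@le_trans _ _ (vsum D 0 (rcons l2 1))); first by rewrite vsum_cat1 lerDl.
apply: hB; split; last by rewrite last_rcons.
by rewrite rcons_path pl2 lt_neqAle x1.
Qed.

Lemma powRD_le (R : realType) (a b p : R) : 0 <= p -> 0 <= a -> 0 <= b ->
  (a + b) `^ p <= 2 `^ p * (a `^ p + b `^ p).
Proof.
move=> p0 a0 b0.
have key (c d : R) : 0 <= c -> c <= d -> (c + d) `^ p <= 2 `^ p * (c `^ p + d `^ p).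
  move=> c0 cd; apply: (@le_trans _ _ (2 `^ p * d `^ p)).
    rewrite -powRM//; last exact: le_trans cd.
    by apply: ge0_ler_powR; rewrite ?nnegrE//; lra.
  by rewrite ler_wpM2l ?powR_ge0// lerDr powR_ge0.
have [ab|ba] := leP a b; first exact: key.
by rewrite addrC (addrC (a `^ p)); apply/key/ltW.
Qed.

(** Needed because [tau] may take values below [0]. Instead of cutting the partition at [0], [g t]
    is written as [g (u t) + g (v t) - g 0] with monotone [u] and [v] into [[0, 1]]: [u] is frozen
    at [0] for negative times and [v] at [1] for positive ones. *)
Lemma vsum_periodic_le (R : realType) (g : R -> 'rV[R]_2) (p B x : R) (l : seq R) :
  0 < p -> periodic g 1 ->
  (forall s, itv_partition 0 1 s -> vsum (fun a b => `|g b - g a| `^ p) 0 s <= B) ->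
  path <=%R x l -> -1 <= x -> last x l <= 1 ->
  vsum (fun a b => `|g b - g a| `^ p) x l <= 2 `^ p * (B + B).
Proof.
move=> p0 pg hB pl x1 l1.
pose D a b := `|g b - g a| `^ p.
have D0 a b : 0 <= D a b by exact: powR_ge0.
have D00 a : D a a = 0 by rewrite /D subrr normr0 powR0// gt_eqF.
pose u (t : R) := Num.max t 0; pose v (t : R) := Num.min t 0 + 1.
have gE t : g t = g (u t) + g (v t) - g 0.
  rewrite /u /v; have [h|h] := leP t 0; first by rewrite pg addrAC subrr add0r.
  by rewrite pg addrK.
have u_mono : {homo u : a b / a <= b}.
  by move=> a b ab; rewrite /u ge_max !le_max ab lexx orbT.
have v_mono : {homo v : a b / a <= b}.
  by move=> a b ab; rewrite /v lerD2r le_min !ge_min ab lexx orbT.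
have u0 t : 0 <= u t by rewrite /u le_max lexx orbT.
have u1 t : t <= 1 -> u t <= 1 by move=> t1; rewrite /u ge_max t1 ler01.
have v0 t : -1 <= t -> 0 <= v t.
  by move=> t1; rewrite /v -lerBlDr le_min; apply/andP; split; lra.
have v1 t : v t <= 1 by rewrite /v -lerBrDr subrr ge_min lexx orbT.
clearbody u v.
pose Du a b := D (u a) (u b); pose Dv a b := D (v a) (v b).
have hD a b : a <= b -> D a b <= 2 `^ p * Du a b + 2 `^ p * Dv a b.
  move=> ab; rewrite -mulrDr /Du /Dv /D.
  have -> : g b - g a = (g (u b) - g (u a)) + (g (v b) - g (v a)).
    by rewrite (gE a) (gE b); apply/rowP => i; rewrite !mxE; ring.
  apply: le_trans (powRD_le (ltW p0) (normr_ge0 _) (normr_ge0 _)).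
  by apply: ge0_ler_powR; rewrite ?nnegrE ?addr_ge0 ?ler_normD// ltW.
apply: (le_trans (vsum_le hD pl)).
have := vsum_lin Du Dv (2 `^ p) (2 `^ p) x l; move: (vsum _ _ _) => z ->.
rewrite -mulrDr ler_wpM2l ?powR_ge0// lerD//.
  apply: (@vsum_map_le _ D u); apply: (vsum_partition_le D0 D00 hB) => //.
    by rewrite path_map; apply: sub_path pl => a b; exact: u_mono.
  by rewrite last_map u1.
apply: (@vsum_map_le _ D v); apply: (vsum_partition_le D0 D00 hB).
- by rewrite path_map; apply: sub_path pl => a b; exact: v_mono.
- exact: v0.
- by rewrite last_map.
Qed.

(** * Number of vertices of a simple lattice walk *)

Lemma vsum_size_le (R : realType) (D : R -> R -> R) (s : nat -> R) (a : R) (x : nat) (l : seq nat) :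
  (forall j k, j \in x :: l -> k \in x :: l -> (j < k)%N -> a <= D (s j) (s k)) ->
  path ltn x l -> (size l)%:R * a <= vsum D (s x) (map s l).
Proof.
elim: l x => [|y l IH] x h /=; first by rewrite mul0r.
move=> /andP[xy pl]; rewrite -natr1 mulrDl mul1r addrC lerD//.
  by apply: h; rewrite // !inE eqxx ?orbT.
by apply: IH pl => j k jl kl; apply: h; rewrite inE ?jl ?kl orbT.
Qed.

Lemma size_count_classes (T : Type) (cls : T -> nat) (n : nat) (l : seq T) :
  (forall x, (cls x < n)%N) -> size l = (\sum_(c < n) count (fun x => cls x == c) l)%N.
Proof.
move=> h; elim: l => [|x l IH] /=; first by rewrite big1.
rewrite big_split/= -IH (bigD1 (Ordinal (h x)))//= eqxx big1 ?addn0//.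
by move=> c; rewrite -val_eqE/= eq_sym => /negbTE ->.
Qed.

(** With modulus [8], distinct vertices of one class are [8 * e] apart in some coordinate; giving up
    [2 * e] at each end leaves more than the distance [e] needed between curve points. *)
Definition cell_class (v : int * int) : nat := absz ((v.1 %% 8)%Z * 8 + (v.2 %% 8)%Z).

Lemma cell_class_lt v : (cell_class v < 64)%N.
Proof. by rewrite /cell_class; lia. Qed.

Lemma cell_class_far (v v' : int * int) : cell_class v = cell_class v' -> v <> v' ->
  8 <= `|v.1 - v'.1| \/ 8 <= `|v.2 - v'.2|.
Proof.
case: v v' => [a b] [c d]; rewrite /cell_class /= => h ne.
have : ~~ ((a == c) && (b == d)) by apply/negP => /andP[/eqP ea /eqP eb]; apply: ne; rewrite ea eb.
clear ne; move=> ne.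
have : (8 <= `|a - c|) || (8 <= `|b - d|) by lia.
by move=> /orP.
Qed.

(* Vertices in the same residue class mod 8 are far apart, so each of the 64
   classes contributes at most [1 + B / e ^ p] vertices. *)
Lemma walk_length_le (R : realType) (g : R -> 'rV[R]_2) (e p B : R) (m : nat)
    (w : int -> int * int) (s : int -> R) :
  0 < e -> 0 < p -> 
  closed_walk (lattice_near g e) int_adj m w s ->
  (forall i j, w i = w j -> (m%:Z %| i - j)%Z) ->
  (forall x l, path <=%R x l -> -1 <= x -> last x l <= 1 ->
     vsum (fun a b => `|g b - g a| `^ p) x l <= B) ->
  m%:R * e `^ p <= 64%:R * (e `^ p + B).
Proof.
move=> e0 p0 [m0 pw ps gap edge] inj hB.
have smono : forall i k, i <= k -> s i <= s k.
  by apply: walk_time_mono => i; have := gap i; lra.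
(* From such an index on, the vertices of one lap have their times in [[-1, 1]], where [hB]
   applies. *)
have [j0 /andP[j1 j2]] : exists j, -1 <= s j <= 0.
  have psz (k : int) : s (k * m%:Z) = s 0 + k%:~R.
    have pn (n : nat) i : s (i + n%:Z * m%:Z) = s i + n%:R.
      elim: n i => [|n IH] i; first by rewrite mul0r !addr0.
      by rewrite intS mulrDl mul1r addrA IH ps -natr1; ring.
    case: k => q; first by rewrite -[X in s X]add0r pn.
    have := pn q.+1 (- (q.+1%:Z * m%:Z)); rewrite addNr => ->.
    by rewrite NegzE mulrNz -pmulrn mulNr addrK.
  have := floor_itv (s 0); rewrite intrD => h.
  by exists (- (Num.floor (s 0) + 1) * m%:Z); rewrite psz mulrNz intrD; lra.
pose t (k : nat) := s (j0 + k%:Z).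
have far j k : (j < k)%N -> (k < m)%N -> cell_class (w (j0 + j%:Z)) = cell_class (w (j0 + k%:Z)) ->
    e `^ p <= `|g (t k) - g (t j)| `^ p.
  move=> jk km cE; apply: ge0_ler_powR; rewrite ?nnegrE ?(ltW e0) ?(ltW p0)//.
  have ne : w (j0 + j%:Z) <> w (j0 + k%:Z).
    move=> /inj/dvdzP[q qE]; move: jk km qE; clear.
    by have [->|] := eqVneq q 0; nia.
  have [[a1 a2] _ _] := edge (j0 + j%:Z); have [[b1 b2] _ _] := edge (j0 + k%:Z).
  have big (u v : int) : 8 <= `|u - v| -> 8 * e <= `|e * u%:~R - e * v%:~R|.
    move=> h; rewrite -mulrBr normrM gtr0_norm// mulrC (ler_pM2l e0).
    by rewrite -intrB -intr_norm -[8]/(8%:~R : R) ler_int.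
  have fin (x y u v : R) : `|x - u| <= 2 * e -> `|y - v| <= 2 * e -> 8 * e <= `|x - y| -> e <= `|v - u|.
    rewrite !ler_norml => h1 h2; have [h|h] := leP 0 (x - y).
      by rewrite (ger0_norm h) => h3; have := ler_norm (u - v); rewrite distrC; lra.
    by rewrite (ltr0_norm h) => h3; have := ler_norm (v - u); lra.
  have [h|h] := cell_class_far cE ne.
    have := coord_le_norm (g (t k) - g (t j)) 0; rewrite !mxE; apply: le_trans.
    exact: fin a1 b1 (big _ _ h).
  have := coord_le_norm (g (t k) - g (t j)) 1; rewrite !mxE; apply: le_trans.
  exact: fin a2 b2 (big _ _ h).
have tmono j k : (j <= k)%N -> t j <= t k by move=> jk; apply: smono; rewrite lerD2l lez_nat.
have t0 k : -1 <= t k by apply: (le_trans j1); apply: smono; rewrite lerDl.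
have t1 k : (k < m)%N -> t k <= 1.
  move=> km; apply: (@le_trans _ _ (t m)); first exact/tmono/ltnW.
  by rewrite /t ps; lra.
have B0 : 0 <= B by have := hB 0 [::] isT; rewrite /=; apply; lra.
pose cls (k : nat) := cell_class (w (j0 + k%:Z)).
have cnt c : (count (fun k => cls k == c) (iota 0 m))%:R * e `^ p <= e `^ p + B.
  rewrite -size_filter; set l := (X in size X).
  have lP k : k \in l -> (k < m)%N /\ cls k = c.
    by rewrite mem_filter mem_iota add0n => /andP[/eqP -> /andP[_ ->]].
  have ls : sorted ltn l by apply: sorted_filter; [exact: ltn_trans|exact: iota_ltn_sorted].
  (* A nonempty class has one vertex more than it has increments: the increments are bounded by [B],
     and the extra vertex accounts for the term [e ^ p]. *)
  case: l lP ls => [|k l] lP /= ls; first by rewrite mul0r addr_ge0// powR_ge0.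
  rewrite -natr1 mulrDl mul1r addrC lerD2l.
  apply: (le_trans (vsum_size_le (D := fun a b => `|g b - g a| `^ p) (s := t) _ ls)).
    move=> i j /lP[im ic] /lP[jm jc] ij; apply: far => //.
    by rewrite -/(cls i) -/(cls j) ic jc.
  apply: hB => //.
    by rewrite path_map; apply: sub_path ls => i j /ltnW; exact: tmono.
  rewrite last_map; apply: t1; have : last k l \in k :: l by exact: mem_last.
  by move=> /lP[].
have := @size_count_classes nat cls 64 (iota 0 m) (fun k => cell_class_lt _).
rewrite size_iota => ->; rewrite natr_sum mulr_suml.
apply: (@le_trans _ _ (\sum_(c < 64) (e `^ p + B))); first by apply: ler_sum => c _; exact: cnt.
by rewrite sumr_const card_ord mulr_natl.
Qed.

(** * Approximation in variation *)

Lemma powR_small (R : realType) (r K t : R) : 0 < r -> 0 <= K -> 0 < t ->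
  exists2 x0, 0 < x0 & forall x, 0 <= x <= x0 -> x `^ r * K <= t.
Proof.
move=> r0 K0 t0; exists ((t / (K + 1)) `^ r^-1).
  by apply: powR_gt0; apply: divr_gt0 => //; lra.
move=> x /andP[x0 xx0].
have h : x `^ r <= t / (K + 1).
  have -> : t / (K + 1) = ((t / (K + 1)) `^ r^-1) `^ r.
    by rewrite -powRrM mulVf ?gt_eqF// powRr1// divr_ge0//; lra.
  by apply: ge0_ler_powR; rewrite ?nnegrE ?powR_ge0// ltW.
have := ler_wpM2r K0 h.
have : t / (K + 1) * K <= t by rewrite mulrAC ler_pdivrMr; [nra|lra].
lra.
Qed.

(** Used in [jordan_smooth_approx] with exponent [p] for [P - g], and with [1] in place of [p] for
    the Lipschitz difference [h - P]. *)
Lemma powR_interpolate (R : realType) (x y p q : R) : 0 < p -> p < q -> 0 <= x -> x <= y ->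
  x `^ q <= y `^ (q - p) * x `^ p.
Proof.
move=> p0 pq x0 xy.
have -> : q = (q - p) + p by ring.
rewrite powRD; last by rewrite subrK; apply/implyP => /eqP h; lra.
rewrite addrK ler_wpM2r ?powR_ge0//.
by apply: ge0_ler_powR; rewrite ?nnegrE//; lra.
Qed.

(** Here [d] is the number of edges travelled. If [d >= 1], the error [4 * e] is charged to them; if
    [d < 1], the linear bound is used, with [d ^ p <= d] as [p >= 1]. Either way the error is linear
    in [d], so it telescopes along a partition. *)
Lemma lattice_increment_le (R : realType) (x y e d p : R) : 1 <= p ->
  0 < e -> 0 <= d -> 0 <= x -> 0 <= y -> x <= y + 4 * e -> x <= e * d ->
  x `^ p <= 2 `^ p * y `^ p + 8 `^ p * e `^ p * d.
Proof.
move=> p1 e0 d0 x0 y0 h1 h2; have p0 : 0 < p by lra.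
have [d1|d1] := leP 1 d.
  apply: (@le_trans _ _ ((y + 4 * e) `^ p)).
    by apply: ge0_ler_powR; rewrite ?nnegrE//; lra.
  apply: (le_trans (powRD_le (ltW p0) y0 (_ : 0 <= 4 * e))); first by rewrite mulr_ge0// ltW.
  rewrite mulrDr lerD2l -!powRM ?(ltW e0)//; last by rewrite mulr_ge0// ltW.
  have -> : 2 * (4 * e) = 8 * e by ring.
  by rewrite -[X in X <= _]mulr1 ler_wpM2l// powR_ge0.
apply: (@le_trans _ _ ((e * d) `^ p)).
  by apply: ge0_ler_powR; rewrite ?nnegrE// ?mulr_ge0//; lra.
apply: (@le_trans _ _ (e `^ p * d)).
  rewrite powRM// ?(ltW e0)// ler_wpM2l ?powR_ge0//.
  have [->|dn0] := eqVneq d 0; first by rewrite powR0// gt_eqF.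
  by apply: ge1r_powR => //; rewrite lt_neqAle eq_sym dn0 d0 ltW.
rewrite -[X in X <= _]add0r lerD ?mulr_ge0 ?powR_ge0//.
rewrite -mulrA ler_peMl ?mulr_ge0 ?powR_ge0//.
have h8 : (1 : R) `^ p <= 8 `^ p by apply: ge0_ler_powR; rewrite ?nnegrE//; lra.
by move: h8; rewrite powR1.
Qed.

Lemma itv_partition_path (R : realType) (s : seq R) :
  itv_partition 0 1 s -> path <=%R 0 s /\ last 0 s = 1.
Proof.
by move=> [ps /eqP ls]; split => //; apply: sub_path ps => a b; exact: ltW.
Qed.

Lemma lipschitz_norm (R : realType) (L : R) (g : R -> 'rV[R]_2) (a b : R) :
  (forall i, lipschitz_fun L (fun t => g t 0 i)) -> a <= b -> `|g b - g a| <= L * (b - a).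
Proof.
move=> lg ab; have L0 : 0 <= L.
  by have := lg 0 1 0; rewrite subr0 normr1 mulr1; apply: le_trans.
apply: norm_rV_le; first by rewrite mulr_ge0// subr_ge0.
by move=> i; rewrite !mxE; have := lg i b a; rewrite [X in _ * X]ger0_norm// subr_ge0.
Qed.

Lemma jordan_smooth_approx (R : realType) (p q B0 : R) (g : R -> 'rV[R]_2) (k : R) :
  1 <= p -> p < q -> jordan_parametrization g ->
  (forall s, itv_partition 0 1 s -> vsum (fun a b => `|g b - g a| `^ p) 0 s <= B0) ->
  0 < k ->
  exists h, [/\ smooth_jordan_embedding h, enorm (h 0 - g 0) <= k &
    forall s, itv_partition 0 1 s -> rvariation_sum q (h \- g) s <= k `^ q].
Proof.
move=> p1 pq jg hB0 k0; have [pg _ _] := jg.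
have p0 : 0 < p by lra.
have q0 : 0 < q by lra.
pose B := 2 `^ p * (B0 + B0).
have hB x l : path <=%R x l -> -1 <= x -> last x l <= 1 ->
   vsum (fun a b => `|g b - g a| `^ p) x l <= B by exact: vsum_periodic_le.
have B00 : 0 <= B0.
  apply: le_trans (hB0 [:: 1] (itv_partition1 ltr01)).
  by apply: vsum_ge0 => a b; exact: powR_ge0.
have Bge0 : 0 <= B by rewrite mulr_ge0 ?powR_ge0 ?addr_ge0.
(* Bound for the [p]-variation sums of [P]: increments of [g] along [tau], plus [8 ^ p * e ^ p] per
   edge with [m * e ^ p <= 64 * (1 + B)]. It does not involve [eta], which can therefore be chosen
   after it. *)
pose C := 2 `^ p * B + 8 `^ p * (64%:R * (1 + B)).
have C0 : 0 <= C by rewrite addr_ge0 ?mulr_ge0 ?powR_ge0 ?addr_ge0.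
have kq : 0 < k `^ q / 2 by rewrite divr_gt0// powR_gt0.
have qp0 : 0 < q - p by rewrite subr_gt0.
have K0 : 0 <= 4 `^ q * (2 `^ p * (C + B0)).
  by do 2![apply: mulr_ge0; first exact: powR_ge0]; exact: addr_ge0.
have [x0 x00 hx0] := powR_small qp0 K0 kq.
(* The bound [1] controls [e ^ p]; [x0 / 6] is used as increments of [P - g] are at most
   [2 * (3 * eta)]; [k / 12] as the Euclidean distance at [0] is at most [2 * (3 * eta + del)] with
   [del <= k / 4]. *)
pose eta := Num.min (Num.min 1 (x0 / 6)) (k / 12).
have eta0 : 0 < eta by rewrite !lt_min ltr01 !divr_gt0.
have eta1 : eta <= 1 by rewrite !ge_min lexx.
have etax : eta <= x0 / 6 by rewrite !ge_min lexx !orbT.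
have etak : eta <= k / 12 by rewrite !ge_min lexx !orbT.
have [e [m [w [s [phi [P]]]]]] := lattice_approx jg eta0.
set tau := fun t => s (Num.floor (phi t)).
move=> /= [/andP[e0 ee] [cw inj] hP1 hP2 [pP iP [L [d [c [lP d0 c0 mP]]]]]].
have me : m%:R * e `^ p <= 64%:R * (1 + B).
  apply: (le_trans (walk_length_le e0 p0 cw inj hB)).
  have h8 : e `^ p <= 1 `^ p by apply: ge0_ler_powR; rewrite ?nnegrE//; lra.
  by rewrite powR1 in h8; rewrite ler_wpM2l// lerD2r.
have VP l : itv_partition 0 1 l -> vsum (fun a b => `|P b - P a| `^ p) 0 l <= C.
  move=> /itv_partition_path[pl ll].
  pose D1 a b := `|g (tau b) - g (tau a)| `^ p; pose D2 a b := phi b - phi a.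
  have hD a b : a <= b -> `|P b - P a| `^ p <= 2 `^ p * D1 a b + 8 `^ p * e `^ p * D2 a b.
    move=> ab; have [h1 h2 h3 h4] := hP2 _ _ ab.
    by apply: lattice_increment_le; rewrite ?subr_ge0.
  apply: (le_trans (vsum_le hD pl)).
  have := vsum_lin D1 D2 (2 `^ p) (8 `^ p * e `^ p) 0 l; move: (vsum _ _ _) => z ->.
  rewrite (vsum_telescope phi) ll.
  have [phi1 _ _] := hP1 0; rewrite add0r in phi1.
  rewrite phi1 addrAC subrr add0r; apply: lerD.
    rewrite ler_wpM2l ?powR_ge0//.
    apply: (@vsum_map_le _ (fun a b => `|g b - g a| `^ p) tau); apply: hB.
    - by rewrite path_map; apply: sub_path pl => a b ab; have [] := hP2 _ _ ab.
    - by have [_ _ /andP[]] := hP1 0; rewrite sub0r.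
    - by rewrite last_map ll; have [_ _ /andP[]] := hP1 1.
  by rewrite -mulrA ler_wpM2l ?powR_ge0// mulrC.
have L0 : 0 <= L.
  by have := lP 0 1 0; rewrite subr0 normr1 mulr1; apply: le_trans.
have K1 : 0 <= 4 `^ q * (2 * L) by rewrite !mulr_ge0 ?powR_ge0.
have q1 : 0 < q - 1 by lra.
have [y0 y00 hy0] := powR_small q1 K1 kq.
pose del := Num.min (y0 / 2) (k / 4).
have del0 : 0 < del by rewrite lt_min !divr_gt0.
have dely : del <= y0 / 2 by rewrite ge_min lexx.
have delk : del <= k / 4 by rewrite ge_min lexx orbT.
have [h [jh hP lh]] := smoothing pP iP lP d0 c0 mP del0.
exists h; split => //.
  apply: (le_trans (enorm_le _)).
  have -> : h 0 - g 0 = (h 0 - P 0) + (P 0 - g 0) by rewrite addrA subrK.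
  have := ler_normD (h 0 - P 0) (P 0 - g 0).
  have := hP 0; have [_ hh _] := hP1 0.
  by move: hh; lra.
move=> l hl; have [pl ll] := itv_partition_path hl.
rewrite rvariation_sumE.
pose D1 a b := `|(h b - P b) - (h a - P a)| `^ q.
pose D2 a b := `|(P b - g b) - (P a - g a)| `^ q.
(* One factor [2 ^ q] passes from the Euclidean to the sup norm, the other splits [h - g] through
   [P]. *)
have hD a b : a <= b ->
    enorm ((h \- g) b - (h \- g) a) `^ q <= 4 `^ q * D1 a b + 4 `^ q * D2 a b.
  move=> ab; rewrite -mulrDr.
  have -> : 4 `^ q = 2 `^ q * 2 `^ q :> R by rewrite -powRM//; congr (_ `^ _); ring.
  apply: (@le_trans _ _ ((2 * `|(h \- g) b - (h \- g) a|) `^ q)).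
    apply: ge0_ler_powR; rewrite ?nnegrE ?enorm_le ?mulr_ge0 ?(ltW q0)//.
    exact: sqrtr_ge0.
  rewrite powRM// -mulrA ler_wpM2l ?powR_ge0//.
  apply: le_trans (powRD_le (ltW q0) (normr_ge0 _) (normr_ge0 _)).
  apply: ge0_ler_powR; rewrite ?nnegrE ?addr_ge0 ?(ltW q0)//.
  apply: le_trans (ler_normD _ _); rewrite le_eqVlt; apply/orP; left; apply/eqP.
  by congr (`|_|); apply/rowP => i; rewrite !mxE; ring.
apply: (le_trans (vsum_le hD pl)).
have := vsum_lin D1 D2 (4 `^ q) (4 `^ q) 0 l; move: (vsum _ _ _) => z ->.
have -> : k `^ q = k `^ q / 2 + k `^ q / 2 by field.
apply: lerD.
  have h1 a b : a <= b -> D1 a b <= (2 * del) `^ (q - 1) * (2 * L) * (b - a).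
    move=> ab; rewrite /D1.
    have n1 : `|h b - P b - (h a - P a)| <= 2 * del.
      apply: (le_trans (ler_normB _ _)); have := hP a; have := hP b; lra.
    have q1' : 1 < q by lra.
    apply: (le_trans (powR_interpolate ltr01 q1' (normr_ge0 _) n1)).
    rewrite powRr1// -mulrA ler_wpM2l ?powR_ge0//.
    have -> : h b - P b - (h a - P a) = (h b - h a) - (P b - P a).
      by apply/rowP => i; rewrite !mxE; ring.
    apply: (le_trans (ler_normB _ _)).
    have := lipschitz_norm lh ab; have := lipschitz_norm lP ab; lra.
  (* The zero summand only provides the shape of [vsum_lin], which extracts the constant. *)
  have := vsum_le (D' := fun a b => (2 * del) `^ (q - 1) * (2 * L) * (b - a) + 0 * (b - a)) _ pl.
  move=> /(_ D1) hh.
  have {hh}hh : vsum D1 0 l <= (2 * del) `^ (q - 1) * (2 * L).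
    apply: (le_trans (hh _)); first by move=> a b ab; rewrite mul0r addr0; exact: h1.
    rewrite (vsum_lin (fun a b => b - a) (fun a b => b - a)) (vsum_telescope id) ll.
    by rewrite mul0r addr0 subr0 mulr1.
  apply: (le_trans (ler_wpM2l (powR_ge0 4 q) hh)).
  rewrite mulrCA; apply: hy0; apply/andP; split; lra.
have h1 a b : a <= b -> D2 a b <= (6 * eta) `^ (q - p) * 2 `^ p * `|P b - P a| `^ p +
    (6 * eta) `^ (q - p) * 2 `^ p * `|g b - g a| `^ p.
  move=> ab; rewrite /D2 -mulrDr.
  have n1 : `|P b - g b - (P a - g a)| <= 6 * eta.
    apply: (le_trans (ler_normB _ _)).
    by have [_ ha _] := hP1 a; have [_ hb _] := hP1 b; lra.
  apply: (le_trans (powR_interpolate p0 pq (normr_ge0 _) n1)).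
  rewrite -mulrA ler_wpM2l ?powR_ge0//.
  apply: le_trans (powRD_le (ltW p0) (normr_ge0 _) (normr_ge0 _)).
  apply: ge0_ler_powR; rewrite ?nnegrE ?addr_ge0 ?(ltW p0)//.
  apply: le_trans (ler_normB _ _); rewrite le_eqVlt; apply/orP; left; apply/eqP.
  by congr (`|_|); apply/rowP => i; rewrite !mxE; ring.
have hh : vsum D2 0 l <= (6 * eta) `^ (q - p) * (2 `^ p * (C + B0)).
  apply: (le_trans (vsum_le h1 pl)).
  rewrite (vsum_lin (fun a b => `|P b - P a| `^ p) (fun a b => `|g b - g a| `^ p)).
  rewrite -mulrDr -mulrA !ler_wpM2l ?powR_ge0//.
  by apply: lerD; [exact: VP|exact: hB0].
apply: (le_trans (ler_wpM2l (powR_ge0 4 q) hh)).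
rewrite mulrCA; apply: hx0; apply/andP; split; lra.
Qed.

Theorem theorem1p2 (R : realType) (p : R) (gamma : R -> 'rV[R]_2) :
  1 <= p ->
  jordan_parametrization gamma ->
  (rvar p gamma < +oo)%E ->
  forall q : R, p < q ->
  exists gamma_ : nat -> R -> 'rV[R]_2,
    (forall n : nat, smooth_jordan_embedding (gamma_ n)) /\
    ((enorm (gamma_ n 0 - gamma 0)%R)%:E + rvar q (gamma_ n \- gamma)%R)%E
      @[n --> \oo] --> (0 : \bar R)%E.
Proof.
move=> p1 jg fin q pq; have p0 : 0 < p by lra.
have q0 : 0 < q by lra.
have [B0 hB0] : exists B0, forall s, itv_partition 0 1 s ->
    vsum (fun a b => `|gamma b - gamma a| `^ p) 0 s <= B0.
  move: fin; rewrite /rvar; set S := [set _ | _ in _] => fin.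
  have pv0 : p^-1 != 0 by rewrite invr_eq0 gt_eqF.
  have {}fin := lty_poweRy pv0 fin.
  exists (fine (ereal_sup S)) => s hs.
  have sup_ge : ((rvariation_sum p gamma s)%:E <= ereal_sup S)%E.
    by apply: ereal_sup_ubound; exists s.
  have fin' : ereal_sup S \is a fin_num.
    by apply: fin_real; rewrite fin andbT (lt_le_trans _ sup_ge)// ltNyr.
  apply: (@le_trans _ _ (rvariation_sum p gamma s)); last by rewrite -lee_fin fineK.
  rewrite rvariation_sumE; have [pl _] := itv_partition_path hs.
  apply: vsum_le pl => a b _; apply: ge0_ler_powR; rewrite ?nnegrE ?(ltW p0)//.
    exact: sqrtr_ge0.
  exact: norm_le_enorm.
have hn n : 0 < (n.+1%:R : R)^-1 by rewrite invr_gt0.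
have [h hh] := choice (fun n => jordan_smooth_approx p1 pq jg hB0 (hn n)).
exists h; split; first by move=> n; have [] := hh n.
(* [harmonic n] is the tolerance imposed on [h n]; it is spent once on the value at [0] and once on
   the variation. *)
have lim : ((2 * harmonic n)%:E : \bar R)%E @[n --> \oo] --> (0 : \bar R)%E.
  apply: cvg_EFin; first by near=> n.
  rewrite -[0](mulr0 2); apply: cvgMl_tmp => /=; exact: cvg_harmonic.
apply: (squeeze_cvge _ (cvg_cst 0%E) lim).
near=> n; have [_ h1 h2] := hh n; apply/andP; split.
  by rewrite adde_ge0// ?poweR_ge0// lee_fin sqrtr_ge0.
rewrite mulr_natl mulr2n EFinD leeD// ?lee_fin//.
rewrite /rvar; set S := [set _ | _ in _].
have supS : (ereal_sup S <= ((n.+1%:R^-1) `^ q)%:E)%E.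
  by apply: ge_ereal_sup => _ [s hs <-]; rewrite lee_fin; exact: h2.
(* The trivial partition bounds the supremum below; [gt0_ler_poweR] needs a nonnegative base. *)
have S0 : (0 <= ereal_sup S)%E.
  apply: (@le_trans _ _ (rvariation_sum q (h n \- gamma) [:: 1])%:E).
    by rewrite lee_fin rvariation_sumE; apply: vsum_ge0 => a b; exact: powR_ge0.
  by apply: ereal_sup_ubound; exists [:: 1] => //; apply: itv_partition1; exact: ltr01.
have -> : (harmonic n)%:E = ((((n.+1%:R^-1 : R) `^ q)%:E) `^ q^-1)%E.
  by rewrite poweR_EFin -powRrM mulfV ?gt_eqF// powRr1// ltW.
apply: gt0_ler_poweR => //; first by rewrite invr_ge0 ltW.
- by rewrite in_itv/= S0 leey.
- by rewrite in_itv/= lee_fin powR_ge0 leey.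
Unshelve. all: by end_near. Qed.
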